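(* Consider the random asymptotically affine controlled branching model of the context. Fix $\alpha>0$ in the interior of $\mathcal D_\Lambda$ and assume: the law of $\log M$ is non-arithmetic, $\mathbf E|\log M|<\infty$, $\mu:=\mathbf E\log M\ge0$, $\rho:=\Lambda'(\alpha)>\mu$, $\Lambda''(\alpha)\in(0,\infty)$; and there are $C<\infty$, $0\le\beta<\alpha$ with $\mathbf E|D(k)|^\alpha\le C(1+k^\beta)$ for all $k\in\mathbb N_0$. For $x\in\mathbb N_0$ let $X_n^{(x)}$ be the process started from $x$, all initial states being coupled through the same random maps $\Psi_n$, and write $\mathcal V_\alpha(x):=\lim_n X_n^{(x)}/\Delta_n$ (these limits exist simultaneously for all $x$ on one event of full $\mathbf P_\alpha$-probability). Let $(M,\Psi)$ have the first-generation law under $\mathbf P_\alpha$, and let $(\mathcal V_\alpha'(x):x\in\mathbb N_0)$ be a copy of $(\mathcal V_\alpha(x):x\in\mathbb N_0)$ independent of $(M,\Psi)$. Then $$(\mathcal V_\alpha(x):x\in\mathbb N_0)\stackrel d=\bigl(M^{-1}\mathcal V_\alpha'(\Psi(x)):x\in\mathbb N_0\bigr).$$ If $c_\alpha(x):=\mathbf E_\alpha[\mathcal V_\alpha(x)^\alpha]$ and $(Pg)(x):=\mathbf E[g(\Psi(x))]$ (expectation under the original law) for nonnegative $g$ on $\mathbb N_0$, then $$Pc_\alpha=e^{\Lambda(\alpha)}c_\alpha .$$ The function $c_\alpha$ is nonnegative, and if there exist $n\ge0$ and $y\in\mathbb N_0$ with $\mathbf P_x(X_n=y)>0$ and $c_\alpha(y)>0$,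 then $c_\alpha(x)>0$. Finally, if $X_0\sim\nu$ is independent of the marks and the offspring array and $\sum_x\nu(x)x^\alpha<\infty$, then the corresponding moment constant $c_\nu(\alpha):=\lim_{n\to\infty}e^{-n\Lambda(\alpha)}\mathbf E_\nu[X_n^\alpha]$ equals $\sum_x\nu(x)c_\alpha(x)$.
   Context: Notation: $\mathbb N=\{1,2,\dots\}$, $\mathbb N_0=\{0,1,2,\dots\}$. Model. $\xi_{n,j}$ ($n\ge0,j\ge1$) are i.i.d. copies of an $\mathbb N_0$-valued $\xi$ with mean $m:=\mathbf E\xi\in(0,\infty)$. The environmental marks $\mathcal E_n$, $n\ge0$, are i.i.d. and independent of the offspring array and of the initial state. The mark $\mathcal E_n$ determines $A_n\in\mathbb N$, $B_n\in\mathbb N_0$ and a random map $C_n:\mathbb N_0\to\mathbb N_0$ with $C_n(0)=0$ (possibly dependent). Define the random maps $\Psi_n(k):=\sum_{j=1}^{A_nC_n(k)+B_n}\xi_{n,j}$; the process is $X_{n+1}=\Psi_n(X_n)$, and $X^{(x)}_{n+1}=\Psi_n(X_n^{(x)})$, $X_0^{(x)}=x$. $\mathbf P_x$ denotes the law with $X_0=x$. A constant $\lambda\in(0,\infty)$ is fixed. Generic one-generation objects. $(A,B,C)$ has the law of a generation mark, $(\xi_j)_{j\ge1}$ is an independent copy of a row of the offspring array, $\Psi(k):=\sum_{j=1}^{AC(k)+B}\xi_j$, $M:=m\lambda A$, $D(k):=\Psi(k)-Mk$. Put $M_n:=m\lambda A_n$, $\Delta_n:=\prod_{j=0}^{n-1}M_j$,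 $\Lambda(\vartheta):=\log\mathbf E[M^\vartheta]$, $\mathcal D_\Lambda:=\{\vartheta\in\mathbb R:\Lambda(\vartheta)<\infty\}$. Tilted law. $\mathbf P_\alpha$ (expectation $\mathbf E_\alpha$) is the law under which the marks are tilted by $d\mathbf P_\alpha/d\mathbf P=\Delta_n^\alpha e^{-n\Lambda(\alpha)}$ on the first $n$ marks, for each $n$; conditional on the marks, the offspring law is unchanged. *)

(* Defs.v *)
From HB Require Import structures.
From mathcomp Require Import all_boot all_order all_algebra.
From mathcomp Require Import all_classical all_reals all_analysis.

Set Implicit Arguments.
Unset Strict Implicit.
Unset Printing Implicit Defensive.

Import Order.TTheory GRing.Theory Num.Theory.
Import numFieldNormedType.Exports.

Local Open Scope classical_set_scope.
Local Open Scope ring_scope.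

Definition coordinate_sets (I : Type) d (U : measurableType d) :
    set (set (I -> U)) :=
  [set A | exists i, exists2 B, measurable B & A = (fun f => f i) @^-1` B].

(* [I -> U] with the product sigma-algebra. *)
Notation process I U := (g_sigma_algebraType (@coordinate_sets I _ U)).

Definition same_law (R : realType) dU (U : measurableType dU)
    d (T : measurableType d) (P : probability T R) (X : T -> U)
    d' (T' : measurableType d') (P' : probability T' R) (Y : T' -> U) : Prop :=
  forall A, measurable A -> P (X @^-1` A) = P' (Y @^-1` A).

Definition independent (R : realType) d (T : measurableType d)
    (P : probability T R) dU (U : measurableType dU) dV (V : measurableType dV)
    (X : T -> U) (Y : T -> V) : Prop :=
  forall A B, measurable A -> measurable B ->
    P (X @^-1` A `&` Y @^-1` B) = (P (X @^-1` A) * P (Y @^-1` B))%E.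

Definition mutually_independent (R : realType) d (T : measurableType d)
    (P : probability T R) (I : choiceType) dU (U : measurableType dU)
    (X : I -> T -> U) : Prop :=
  forall (s : seq I) (B : I -> set U), uniq s -> (forall i, measurable (B i)) ->
    P (\bigcap_(i in [set` s]) X i @^-1` B i) =
    (\prod_(i <- s) P (X i @^-1` B i))%E.

Definition iid (R : realType) d (T : measurableType d)
    (P : probability T R) (I : choiceType) dU (U : measurableType dU)
    (X : I -> T -> U) : Prop :=
  mutually_independent P X /\ forall i j, same_law P (X i) P (X j).

(* The law of [Y] is not carried by a lattice h Z with h > 0. *)
Definition non_arithmetic (R : realType) d (T : measurableType d)
    (P : probability T R) (Y : T -> R) : Prop :=
  forall h : R, 0 < h ->
    P (Y @^-1` [set y | exists z : int, y = h * z%:~R]) != 1%E.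

(* [offspring Z n j] is xi_{n,j+1}. The mark [mark Z n] takes values in an
   arbitrary measurable space [S], on which the functions determining
   A_n, B_n and C_n(k) are defined. *)
Structure branching_data d (T : measurableType d) dS (S : measurableType dS) :=
  BranchingData {
    offspring : nat -> nat -> {mfun T >-> nat};
    mark : nat -> {mfun T >-> S};
    mark_A : {mfun S >-> nat};
    mark_B : {mfun S >-> nat};
    mark_C : nat -> {mfun S >-> nat};
    mark_A_gt0 : forall s, (0 < mark_A s)%N;
    mark_C0 : forall s, mark_C 0%N s = 0%N
  }.

Section branching.
Context (R : realType) d (T : measurableType d) dS (S : measurableType dS).
Variable Z : branching_data T S.

Definition Psi (n k : nat) (w : T) : nat :=
  let e := mark Z n w in
  (\sum_(j < mark_A Z e * mark_C Z k e + mark_B Z e) offspring Z n j w)%N.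

Fixpoint X (x n : nat) (w : T) : nat :=
  if n is n'.+1 then Psi n' (X x n' w) w else x.

Definition marks (w : T) : process nat S := fun n => mark Z n w.
Definition first_marks (n : nat) (w : T) : process 'I_n S :=
  fun i => mark Z i w.
Definition offspring_array (w : T) : process (nat * nat)%type nat :=
  fun nj => offspring Z nj.1 nj.2 w.

Definition iid_environment_and_offspring (P : probability T R) : Prop :=
  [/\ iid P (mark Z),
      iid P (fun nj : nat * nat => offspring Z nj.1 nj.2)
    & independent P marks offspring_array].

(* [m] is the offspring mean; this is imposed where [P] is fixed. *)
Variables (m lambda : R).

Definition M (n : nat) (w : T) : R := m * lambda * (mark_A Z (mark Z n w))%:R.

Definition Delta (n : nat) (w : T) : R := \prod_(j < n) M j w.

(* The generic (M, Psi) is realised by generation 0. *)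
Definition D (k : nat) (w : T) : R := (Psi 0 k w)%:R - M 0 w * k%:R.

Definition Lambda_ext (P : probability T R) (theta : R) : \bar R :=
  lne ('E_P[fun w => (M 0 w `^ theta)%R])%E.

Definition Lambda (P : probability T R) (theta : R) : R :=
  fine (Lambda_ext P theta).

Definition D_Lambda (P : probability T R) : set R :=
  [set theta | (Lambda_ext P theta < +oo)%E].

(* [Pa] has density Delta_n^alpha e^{-n Lambda(alpha)} on the sigma-algebra of
   the first n marks; given the marks, the offspring array keeps under [Pa] the
   law it has under [P], where it is independent of the marks. *)
Definition tilted_law (P : probability T R) (alpha : R)
    (Pa : probability T R) : Prop :=
  [/\ forall n (A : set (process 'I_n S)), measurable A ->
        Pa (@first_marks n @^-1` A) =
        (\int[P]_(w in @first_marks n @^-1` A)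
           (Delta n w `^ alpha * expR (- n%:R * Lambda P alpha))%R%:E)%E,
      independent Pa marks offspring_array
    & same_law Pa offspring_array P offspring_array].

(* [limn] is a default value of [R] where the limit does not exist; under a
   tilted law this is to be shown to be a null event. *)
Definition V (x : nat) (w : T) : R := limn (fun n => (X x n w)%:R / Delta n w).

Definition V_process (w : T) : process nat R := fun x => V x w.

Definition M_Psi (w : T) : (R * process nat nat)%type :=
  (M 0 w, fun k => Psi 0 k w).

Definition moment_const (Pa : probability T R) (alpha : R) (x : nat) : \bar R :=
  ('E_Pa[fun w => (V x w `^ alpha)%R])%E.

Definition transition (P : probability T R) (g : nat -> \bar R) (x : nat) :
    \bar R :=
  (\int[P]_w g (Psi 0 x w))%E.

End branching.

(* Main.v *)
(* Scaled by Delta_n, the process W_n = X_n / Delta_n changes in one step by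
   D_n(X_n) / Delta_(n+1), so under the tilted law the weight Delta_(n+1)^alpha
   cancels:
     E_alpha |W_(n+1) - W_n|^alpha = e^(-(n+1) Lambda(alpha)) E |D_n(X_n)|^alpha
       <= C e^(-(n+1) Lambda(alpha)) (1 + E X_n^beta).
   As beta < alpha and Lambda(alpha) > 0 (strict Jensen inequality: log M has
   nonnegative mean and is not constant), these increments decay geometrically,
   once one knows that E_alpha W_n^alpha grows slower than any exponential. A
   weighted sum of the |W_(n+1) - W_n|^alpha then gives at once the almost sure
   convergence of W_n and an integrable bound for sup_n W_n^alpha which is affine
   in x^alpha, so the moments converge by domination. The distributional equation
   and the harmonicity of c_alpha come from restarting the process after the first
   generation. *)
Require Import Defs.
From HB Require Import structures.
From mathcomp Require Import all_boot all_order all_algebra.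
From mathcomp Require Import all_classical all_reals all_analysis.

From mathcomp Require Import measurable_realfun ring lra.

Set Implicit Arguments.
Unset Strict Implicit.
Unset Printing Implicit Defensive.

Import Order.TTheory GRing.Theory Num.Theory.
Import numFieldNormedType.Exports.

Local Open Scope classical_set_scope.
Local Open Scope ring_scope.

(** * Laws and independence *)

(** [tilted_law] describes [Pa] only through the laws of finitely many marks and of the offspring
    array. The density is therefore used in two places only: to see that the marks stay i.i.d. under
    [Pa], and to untilt generation 0. The second use, combined with a restart, makes the moments of
    W and of its increments satisfy a_(n+1) = e^(-L) P a_n with L = Lambda(alpha), hence a_n(x) =
    e^(-nL) E a_0(X_n); the moment of V is a fixed point of the same rule. This is how quantities
    under [Pa] at time n become expectations under [P]. The obstacle is a circle: the n-th increment
    is bounded by r^n (1 + E_alpha W_n^alpha), with r = e^(-(1 - beta/alpha) L), while E_alpha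
    W_n^alpha is itself controlled through the increments. It is broken by (a + c)^alpha <= b
    a^alpha + K c^alpha, valid for every alpha > 0 and every b > 1 with K depending on b: choosing b
    with r b < 1, the loss b^n is beaten by r^n. Restarting evaluates limits at the shifted
    trajectory, so the model is copied to path space, and the default value of [limn] is arranged to
    respect the restart identity at every point. *)

Section measurability.
Context d (T : measurableType d).

Lemma measurable_fun_nat dU (U : measurableType dU) (f : nat -> U) :
  measurable_fun [set: nat] f.
Proof. by []. Qed.

(** The space splits into the countably many events on which [N] is constant. This covers the random
    number of summands in [Psi] and the random state inserted at each step. *)
Lemma measurable_fun_nat_bind dU (U : measurableType dU) (N : T -> nat)
    (F : nat -> T -> U) :
  measurable_fun [set: T] N -> (forall k, measurable_fun [set: T] (F k)) ->
  measurable_fun [set: T] (fun w => F (N w) w).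
Proof.
move=> mN mF _ B mB; rewrite setTI.
have -> : (fun w => F (N w) w) @^-1` B =
    \bigcup_k (N @^-1` [set k] `&` F k @^-1` B).
  apply/seteqP; split => [w /= Bw|w [k _ [/= <-]]//].
  by exists (N w).
apply: bigcup_measurable => k _; apply: measurableI; rewrite -[X in measurable X]setTI.
  exact: mN.
exact: mF.
Qed.

Lemma measurable_fun_addn (f g : T -> nat) :
  measurable_fun [set: T] f -> measurable_fun [set: T] g ->
  measurable_fun [set: T] (fun w => f w + g w)%N.
Proof.
move=> mf mg.
apply: (measurable_fun_nat_bind (F := fun k w => (k + g w)%N)) => // k.
exact: (measurableT_comp (measurable_fun_nat (addn k))).
Qed.

Lemma measurable_fun_muln (f g : T -> nat) :
  measurable_fun [set: T] f -> measurable_fun [set: T] g ->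
  measurable_fun [set: T] (fun w => f w * g w)%N.
Proof.
move=> mf mg.
apply: (measurable_fun_nat_bind (F := fun k w => (k * g w)%N)) => // k.
exact: (measurableT_comp (measurable_fun_nat (muln k))).
Qed.

Lemma measurable_fun_sumn (f : nat -> T -> nat) n :
  (forall i, measurable_fun [set: T] (f i)) ->
  measurable_fun [set: T] (fun w => \sum_(i < n) f i w)%N.
Proof.
move=> mf; elim: n => [|n IH].
  rewrite [X in measurable_fun _ X](_ : _ = cst 0%N)//.
  by apply/funext => w; rewrite big_ord0.
rewrite [X in measurable_fun _ X](_ : _ = (fun w =>
    (\sum_(i < n) f i w + f n w)%N)).
  exact: measurable_fun_addn.
by apply/funext => w; rewrite big_ord_recr.
Qed.

Lemma preimage_measurable dU (U : measurableType dU) (f : T -> U) A :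
  measurable_fun [set: T] f -> measurable A -> measurable (f @^-1` A).
Proof. by move=> mf mA; rewrite -[X in measurable X]setTI; exact: mf. Qed.

Lemma measurable_fun_process I dU (U : measurableType dU)
    (f : T -> process I U) :
  (forall i, measurable_fun [set: T] (fun w => f w i)) ->
  measurable_fun [set: T] f.
Proof.
move=> mf; apply: (@measurability _ _ T (process I U) _ _ (@coordinate_sets I _ U)) => //.
move=> _ [_ [i [B mB ->]] <-].
exact: (mf i measurableT B mB).
Qed.

End measurability.

Lemma measurable_fun_coordinate I dU (U : measurableType dU) (i : I) :
  measurable_fun [set: process I U] (fun f : process I U => f i).
Proof.
move=> _ B mB; rewrite setTI; apply: sub_sigma_algebra.
by exists i, B.
Qed.

Lemma measurable_fun_reindex I J dU (U : measurableType dU) (r : J -> I) :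
  measurable_fun [set: process I U]
    ((fun f j => f (r j)) : process I U -> process J U).
Proof. by apply: measurable_fun_process => j; exact: measurable_fun_coordinate. Qed.

(** Finite-dimensional rectangles: a pi-system generating the product sigma-algebra, on which mutual
    independence gives explicit products. *)
Definition cylinder (I : choiceType) dU (U : measurableType dU)
    (s : seq I) (B : I -> set U) : set (process I U) :=
  \bigcap_(i in [set` s]) ((fun f => f i) @^-1` B i).

Lemma measurable_cylinder (I : choiceType) dU (U : measurableType dU)
    (s : seq I) (B : I -> set U) :
  (forall i, measurable (B i)) -> measurable (cylinder s B).
Proof.
move=> mB; rewrite /cylinder bigcap_seq; apply: bigsetI_measurable => i _.
exact: (preimage_measurable (@measurable_fun_coordinate I _ U i)).
Qed.

(** * Finite measures determined on rectangles and on cylinders *)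

Section uniqueness.
Context (R : realType).
Local Open Scope ereal_scope.

Lemma rectangle_measure_unique d1 (U : measurableType d1) d2
    (V : measurableType d2) (m1 m2 : {measure set (U * V)%type -> \bar R}) :
  m1 setT < +oo ->
  (forall A B, measurable A -> measurable B -> m1 (A `*` B) = m2 (A `*` B)) ->
  forall A, measurable A -> m1 A = m2 A.
Proof.
move=> m1oo m12.
apply: (@measure_unique _ _ _
  [set A `*` B | A in measurable & B in measurable] (fun=> setT)) => //.
- by rewrite measurable_prod_measurableType.
- move=> _ _ [A mA [B mB <-]] [A' mA' [B' mB' <-]].
  rewrite -setXI; exists (A `&` A'); first exact: measurableI.
  by exists (B `&` B') => //; exact: measurableI.
- by move=> _; exists setT => //; exists setT => //; rewrite setXTT.
- by apply/seteqP; split => // x _; exists 0%N.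
- by move=> _ [A mA [B mB <-]]; exact: m12.
Qed.

Lemma cylinder_measure_unique (I : choiceType) dU (U : measurableType dU)
    (m1 m2 : {measure set (process I U) -> \bar R}) :
  m1 setT < +oo ->
  (forall s B, uniq s -> (forall i, measurable (B i)) ->
     m1 (cylinder s B) = m2 (cylinder s B)) ->
  forall A, measurable A -> m1 A = m2 A.
Proof.
move=> m1oo m12.
pose G := [set A | exists (s : seq I) (B : I -> set U),
  [/\ uniq s, (forall i, measurable (B i)) & A = cylinder s B]].
apply: (@measure_unique _ _ _ G (fun=> setT)) => //.
- apply/seteqP; split.
    apply: smallest_sub; first exact: smallest_sigma_algebra.
    move=> _ [i [B mB ->]]; apply: sub_sigma_algebra.
    exists [:: i], (fun=> B); split => //.
    by rewrite /cylinder bigcap_seq big_seq1.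
  apply: smallest_sub; first exact: sigma_algebra_measurable.
  by move=> _ [s [B [us mB ->]]]; exact: measurable_cylinder.
- move=> _ _ [s [B [us mB ->]]] [s' [B' [us' mB' ->]]].
  (* Two cylinders meet in a cylinder over the union of their index sets; a coordinate constrained
     by only one of them receives the full set from the other. *)
  exists (undup (s ++ s')), (fun i => (if i \in s then B i else setT) `&`
     (if i \in s' then B' i else setT)); split.
  + exact: undup_uniq.
  + by move=> i; apply: measurableI; case: ifP.
  + apply/seteqP; split => f /=.
      move=> [fB fB'] i /=; rewrite mem_undup mem_cat => _; split.
        by case: ifPn => // /fB.
      by case: ifPn => // /fB'.
    move=> fB; split => i /= si.
      by have := fB i; rewrite /= mem_undup mem_cat si => /(_ isT)[].
    by have := fB i; rewrite /= mem_undup mem_cat si orbT => /(_ isT)[].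
- move=> _; exists [::], (fun=> setT); split => //.
  by apply/seteqP; split.
- by apply/seteqP; split => // x _; exists 0%N.
- by move=> _ [s [B [us mB ->]]]; exact: m12.
Qed.

End uniqueness.

(** * Transfer of laws and extension of independence from pi-systems *)

Section laws.
Context (R : realType).
Local Open Scope ereal_scope.

Definition mfun_of d (T : measurableType d) dU (U : measurableType dU)
    (f : T -> U) (mf : measurable_fun [set: T] f) : {mfun T >-> U} :=
  mfun_Sub (mem_set mf).

Lemma same_law_sym d (T : measurableType d) (P : probability T R)
    d' (T' : measurableType d') (P' : probability T' R)
    dU (U : measurableType dU) (X : T -> U) (Y : T' -> U) :
  same_law P X P' Y -> same_law P' Y P X.
Proof. by move=> XY A mA; rewrite XY. Qed.

Lemma same_law_comp d (T : measurableType d) (P : probability T R)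
    d' (T' : measurableType d') (P' : probability T' R)
    dU (U : measurableType dU) dV (V : measurableType dV)
    (X : T -> U) (Y : T' -> U) (f : U -> V) :
  measurable_fun [set: U] f -> same_law P X P' Y ->
  same_law P (fun w => f (X w)) P' (fun w => f (Y w)).
Proof. by move=> mf XY A mA; apply: (XY (f @^-1` A)); exact: preimage_measurable. Qed.

Lemma integral_same_law d (T : measurableType d) (P : probability T R)
    d' (T' : measurableType d') (P' : probability T' R)
    dU (U : measurableType dU) (X : T -> U) (Y : T' -> U) (f : U -> \bar R) :
  measurable_fun [set: T] X -> measurable_fun [set: T'] Y ->
  same_law P X P' Y -> measurable_fun [set: U] f -> (forall u, 0 <= f u) ->
  \int[P]_w f (X w) = \int[P']_w f (Y w).
Proof.
move=> mX mY XY mf f0.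
transitivity (\int[distribution P (mfun_of mX)]_u f u).
  by rewrite ge0_integral_pushforward.
transitivity (\int[distribution P' (mfun_of mY)]_u f u); last first.
  by rewrite ge0_integral_pushforward.
by apply: eq_measure_integral => A mA _; exact: XY.
Qed.

Section one_space.
Context d (T : measurableType d) (P : probability T R).

Lemma independent_comp dU (U : measurableType dU) dV (V : measurableType dV)
    dU' (U' : measurableType dU') dV' (V' : measurableType dV')
    (X : T -> U) (Y : T -> V) (f : U -> U') (g : V -> V') :
  measurable_fun [set: U] f -> measurable_fun [set: V] g ->
  independent P X Y -> independent P (fun w => f (X w)) (fun w => g (Y w)).
Proof.
move=> mf mg XY A B mA mB.
by apply: (XY (f @^-1` A) (g @^-1` B)); exact: preimage_measurable.
Qed.

(* [G] stands for a pi-system on which finite measures are determined. *)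
Lemma event_independent_ext dU (U : measurableType dU) (X : T -> U)
    (G : set (set U)) E :
  measurable_fun [set: T] X -> measurable E ->
  (forall m1 m2 : {measure set U -> \bar R}, m1 setT < +oo ->
     (forall A, G A -> m1 A = m2 A) -> forall A, measurable A -> m1 A = m2 A) ->
  (forall A, G A -> P (X @^-1` A `&` E) = P (X @^-1` A) * P E) ->
  forall A, measurable A -> P (X @^-1` A `&` E) = P (X @^-1` A) * P E.
Proof.
move=> mX mE Gu XE A mA.
have p0 : (0 <= fine (P E))%R by exact: fine_ge0.
(* Both sides are finite measures in [A]: [P] restricted to [E] and pushed forward by [X], and the
   law of [X] scaled by [P E]. *)
pose m1 := pushforward (mrestr P mE) (mfun_of mX).
pose m2 := mscale (NngNum p0) (distribution P (mfun_of mX)).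
have pE : (fine (P E))%:E = P E by rewrite fineK// fin_num_measure.
have := Gu m1 m2 _ _ A mA.
rewrite /m1 /m2 /= /mscale /mrestr /distribution /pushforward /= pE muleC.
apply => //.
  rewrite (le_lt_trans (probability_le1 P _)) ?ltry//.
  by apply: measurableI => //; exact: preimage_measurable.
by move=> C GC; rewrite muleC; exact: XE.
Qed.

(** The extension is made one variable at a time: over the events of [X] with the event of [Y]
    fixed, then over the events of [Y] with an element of [G] fixed. *)
Lemma independent_ext dU (U : measurableType dU) dV (V : measurableType dV)
    (X : T -> U) (Y : T -> V) (G : set (set U)) (H : set (set V)) :
  measurable_fun [set: T] X -> measurable_fun [set: T] Y ->
  G `<=` measurable ->
  (forall m1 m2 : {measure set U -> \bar R}, m1 setT < +oo ->
     (forall A, G A -> m1 A = m2 A) -> forall A, measurable A -> m1 A = m2 A) ->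
  (forall m1 m2 : {measure set V -> \bar R}, m1 setT < +oo ->
     (forall A, H A -> m1 A = m2 A) -> forall A, measurable A -> m1 A = m2 A) ->
  (forall A B, G A -> H B ->
    P (X @^-1` A `&` Y @^-1` B) = P (X @^-1` A) * P (Y @^-1` B)) ->
  independent P X Y.
Proof.
move=> mX mY mG Gu Hu XY A B mA mB.
apply: (event_independent_ext (G := G)) => //; first exact: preimage_measurable.
move=> C GC; rewrite setIC muleC.
apply: (event_independent_ext (G := H)) => //.
  by apply: preimage_measurable => //; exact: mG.
by move=> D HD; rewrite setIC muleC XY.
Qed.

(** The three hypotheses together factor the four events completely, and the factors can be
    regrouped. It serves to pass from the splitting marks/offspring to the splitting first
    generation/later generations. *)
Lemma independent_pairs d1 (U1 : measurableType d1) d2 (U2 : measurableType d2)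
    d3 (V1 : measurableType d3) d4 (V2 : measurableType d4)
    (X1 : T -> U1) (X2 : T -> U2) (Y1 : T -> V1) (Y2 : T -> V2) :
  measurable_fun [set: T] X1 -> measurable_fun [set: T] X2 ->
  measurable_fun [set: T] Y1 -> measurable_fun [set: T] Y2 ->
  independent P X1 Y1 -> independent P X2 Y2 ->
  independent P (fun w => (X1 w, Y1 w)) (fun w => (X2 w, Y2 w)) ->
  independent P (fun w => (X1 w, X2 w)) (fun w => (Y1 w, Y2 w)).
Proof.
move=> mX1 mX2 mY1 mY2 i1 i2 i12.
have quad A1 A2 B1 B2 : measurable A1 -> measurable A2 -> measurable B1 ->
  measurable B2 -> P ((fun w => (X1 w, X2 w)) @^-1` (A1 `*` A2) `&`
     (fun w => (Y1 w, Y2 w)) @^-1` (B1 `*` B2)) =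
  P ((fun w => (X1 w, X2 w)) @^-1` (A1 `*` A2)) *
  P ((fun w => (Y1 w, Y2 w)) @^-1` (B1 `*` B2)).
  move=> mA1 mA2 mB1 mB2.
  have pairE d5 (U5 : measurableType d5) d6 (U6 : measurableType d6)
      (Z1 : T -> U5) (Z2 : T -> U6) C1 C2 :
      (fun w => (Z1 w, Z2 w)) @^-1` (C1 `*` C2) = Z1 @^-1` C1 `&` Z2 @^-1` C2.
    by [].
  (* Full sets in the other coordinates extract the marginal independence from [i12]. *)
  have X12 : P (X1 @^-1` A1 `&` X2 @^-1` A2) = P (X1 @^-1` A1) * P (X2 @^-1` A2).
    have := i12 (A1 `*` setT) (A2 `*` setT).
    by rewrite !pairE !preimage_setT !setIT => ->//; exact: measurableX.
  have Y12 : P (Y1 @^-1` B1 `&` Y2 @^-1` B2) = P (Y1 @^-1` B1) * P (Y2 @^-1` B2).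
    have := i12 (setT `*` B1) (setT `*` B2).
    by rewrite !pairE !preimage_setT !setTI => ->//; exact: measurableX.
  rewrite !pairE X12 Y12 muleACA -i1// -i2//.
  rewrite -!pairE -i12//; [|exact: measurableX..].
  by rewrite !pairE setIACA.
have rect d5 (U5 : measurableType d5) d6 (U6 : measurableType d6)
    (m1 m2 : {measure set (U5 * U6) -> \bar R}) : m1 setT < +oo ->
    (forall A, [set A `*` B | A in measurable & B in measurable] A ->
       m1 A = m2 A) -> forall A, measurable A -> m1 A = m2 A.
  move=> moo m12; apply: rectangle_measure_unique => // A B mA mB.
  by apply: m12; exists A => //; exists B.
apply: (independent_ext _ _ _ (@rect _ U1 _ U2) (@rect _ V1 _ V2)).
- exact: measurable_fun_pair.
- exact: measurable_fun_pair.
- by move=> _ [A1 mA1 [A2 mA2 <-]]; exact: measurableX.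
by move=> _ _ [A1 mA1 [A2 mA2 <-]] [B1 mB1 [B2 mB2 <-]]; exact: quad.
Qed.

End one_space.
End laws.

(** * Joint laws, Fubini for independent variables, and independent blocks of a family *)

Section joint_laws.
Context (R : realType).
Local Open Scope ereal_scope.

Lemma same_law_pair d (T : measurableType d) (P : probability T R)
    d' (T' : measurableType d') (P' : probability T' R)
    dU (U : measurableType dU) dV (V : measurableType dV)
    (X : T -> U) (Y : T -> V) (X' : T' -> U) (Y' : T' -> V) :
  measurable_fun [set: T] X -> measurable_fun [set: T] Y ->
  measurable_fun [set: T'] X' -> measurable_fun [set: T'] Y' ->
  independent P X Y -> independent P' X' Y' ->
  same_law P X P' X' -> same_law P Y P' Y' ->
  same_law P (fun w => (X w, Y w)) P' (fun w => (X' w, Y' w)).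
Proof.
move=> mX mY mX' mY' iXY iXY' lX lY.
apply: (rectangle_measure_unique
  (m1 := distribution P (mfun_of (measurable_fun_pair mX mY)))
  (m2 := distribution P' (mfun_of (measurable_fun_pair mX' mY')))).
  by rewrite (le_lt_trans (probability_le1 _ _)) ?ltry.
move=> A B mA mB.
have := iXY A B mA mB; rewrite lX// lY// -iXY'//; exact.
Qed.

(** The joint law is the product of the marginals, and Tonelli applies. The copy [Y'] may live on
    another space: under the tilted law the offspring row is thus integrated under the original
    one. *)
Lemma integral_independent d (T : measurableType d) (P : probability T R)
    d' (T' : measurableType d') (P' : probability T' R)
    dU (U : measurableType dU) dV (V : measurableType dV)
    (X : T -> U) (Y : T -> V) (Y' : T' -> V) (F : U * V -> \bar R) :
  measurable_fun [set: T] X -> measurable_fun [set: T] Y ->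
  measurable_fun [set: T'] Y' ->
  independent P X Y -> same_law P Y P' Y' ->
  measurable_fun [set: U * V] F -> (forall z, 0 <= F z) ->
  \int[P]_w F (X w, Y w) = \int[P]_w \int[P']_w' F (X w, Y' w').
Proof.
move=> mX mY mY' iXY lY mF F0.
pose mXY := measurable_fun_pair mX mY.
transitivity (\int[distribution P (mfun_of mXY)]_z F z).
  by rewrite ge0_integral_pushforward.
pose m1 := distribution P (mfun_of mX).
pose m2 := distribution P' (mfun_of mY').
transitivity (\int[m1 \x m2]_z F z).
  apply: eq_measure_integral => A mA _; apply/esym.
  apply: product_measure_unique => // B C mB mC.
  by have := iXY B C mB mC; rewrite (lY C)//; exact.
rewrite fubini_tonelli1// ge0_integral_pushforward//=; last 2 first.
- exact: measurable_fun_fubini_tonelli_F.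
- by move=> u _; apply: integral_ge0.
apply: eq_integral => w _; rewrite /fubini_F /= ge0_integral_pushforward//.
exact: (measurableT_comp mF (measurable_fun_pair _ _)).
Qed.

Lemma measurable_fun_partial_integral d (T : measurableType d)
    (P : probability T R) dU (U : measurableType dU) dV (V : measurableType dV)
    (Y : T -> V) (F : U * V -> \bar R) :
  measurable_fun [set: T] Y ->
  measurable_fun [set: U * V] F -> (forall z, 0 <= F z) ->
  measurable_fun [set: U] (fun u => \int[P]_w F (u, Y w)).
Proof.
move=> mY mF F0.
have := @measurable_fun_fubini_tonelli_F _ _ _ _ _ (distribution P (mfun_of mY)) F mF F0.
apply: eq_measurable_fun => u _.
rewrite /fubini_F ge0_integral_pushforward//.
exact: (measurableT_comp mF (measurable_fun_pair _ _)).
Qed.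

Section one_space.
Context d (T : measurableType d) (P : probability T R).

Lemma integral_independentM dU (U : measurableType dU)
    dV (V : measurableType dV) (X : T -> U) (Y : T -> V)
    (f : U -> \bar R) (g : V -> \bar R) :
  measurable_fun [set: T] X -> measurable_fun [set: T] Y ->
  independent P X Y ->
  measurable_fun [set: U] f -> (forall u, 0 <= f u) ->
  measurable_fun [set: V] g -> (forall v, 0 <= g v) ->
  \int[P]_w (f (X w) * g (Y w)) = \int[P]_w f (X w) * \int[P]_w g (Y w).
Proof.
move=> mX mY iXY mf f0 mg g0.
rewrite (integral_independent (Y' := Y) (P' := P)
  (F := fun z => f z.1 * g z.2) mX mY)//=; last 2 first.
- apply: emeasurable_funM.
  + exact: (measurableT_comp mf measurable_fst).
  + exact: (measurableT_comp mg measurable_snd).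
- by move=> z; apply: mule_ge0.
have mgY : measurable_fun [set: T] (fun w => g (Y w)) by exact: measurableT_comp.
have mfX : measurable_fun [set: T] (fun w => f (X w)) by exact: measurableT_comp.
under eq_integral do rewrite ge0_integralZl//.
by rewrite ge0_integralZr//; exact: integral_ge0.
Qed.

Lemma mutually_independent_reindex (I J : choiceType) dU (U : measurableType dU)
    (Y : I -> T -> U) (r : J -> I) : injective r ->
  mutually_independent P Y -> mutually_independent P (fun j => Y (r j)).
Proof.
move=> rI iY s B us mB.
(* The sets are carried to the indices in the range of [r] and filled up with full sets; injectivity
   makes the chosen preimage the right one. *)
pose B' i := if pselect (exists j, r j = i) is left e then B (projT1 (cid e))
  else setT.
have B'E j : B' (r j) = B j.
  rewrite /B'; case: pselect => [e|[]]; last by exists j.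
  by congr B; case: cid => /= k /rI.
rewrite (_ : \bigcap_(j in _) _ =
    \bigcap_(i in [set` map r s]) (Y i @^-1` B' i)); last first.
  by rewrite !bigcap_seq big_map; apply: eq_bigr => j _; rewrite B'E.
rewrite iY ?big_map ?map_inj_uniq//; first by apply: eq_bigr => j _; rewrite B'E.
by move=> i; rewrite /B'; case: pselect.
Qed.

(** Both cylinder probabilities are products of one-coordinate probabilities, which agree. With
    [succn] against the identity this is stationarity. *)
Lemma iid_reindex_same_law (I J : choiceType) dU (U : measurableType dU)
    (Y : I -> T -> U) (r r' : J -> I) :
  (forall i, measurable_fun [set: T] (Y i)) -> injective r -> injective r' ->
  iid P Y ->
  same_law P ((fun w j => Y (r j) w) : T -> process J U)
    P ((fun w j => Y (r' j) w) : T -> process J U).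
Proof.
move=> mY rI rI' [iY lY].
have mYr q : measurable_fun [set: T] ((fun w j => Y (q j) w) : T -> process J U).
  by apply: measurable_fun_process.
apply: (cylinder_measure_unique (m1 := distribution P (mfun_of (mYr r)))
  (m2 := distribution P (mfun_of (mYr r')))).
  by rewrite (le_lt_trans (probability_le1 _ _)) ?ltry.
move=> s B us mB.
transitivity (\prod_(j <- s) P (Y (r j) @^-1` B j)).
  exact: (mutually_independent_reindex rI iY us mB).
transitivity (\prod_(j <- s) P (Y (r' j) @^-1` B j)).
  by apply: eq_bigr => j _; exact: lY.
exact/esym/(mutually_independent_reindex rI' iY us mB).
Qed.

Lemma mutually_independent_split (I J K : choiceType) dU (U : measurableType dU)
    (Y : I -> T -> U) (r : J -> I) (q : K -> I) :
  (forall i, measurable_fun [set: T] (Y i)) -> injective r -> injective q ->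
  (forall j k, r j <> q k) -> mutually_independent P Y ->
  independent P ((fun w j => Y (r j) w) : T -> process J U)
    ((fun w k => Y (q k) w) : T -> process K U).
Proof.
move=> mY rI qI rq iY.
(* The two disjoint blocks become one injectively indexed family over [J + K], whose cylinder
   probabilities are products over both blocks. *)
pose rr (x : J + K) := match x with inl j => r j | inr k => q k end.
have rrI : injective rr.
  move=> [j|k] [j'|k'] //=; first by move/rI->.
  - by move=> /rq.
  - by move=> /esym /rq.
  - by move/qI->.
have iYr := mutually_independent_reindex rrI iY.
have uniqE (L : choiceType) (m1 m2 : {measure set process L U -> \bar R}) :
    m1 setT < +oo ->
    (forall A, [set A | exists s B, [/\ uniq s,
      (forall i, measurable (B i)) & A = cylinder s B]] A -> m1 A = m2 A) ->
    forall A, measurable A -> m1 A = m2 A.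
  move=> m1oo m12; apply: cylinder_measure_unique => // s B us mB.
  by apply: m12; exists s, B.
apply: (independent_ext _ _ _ (uniqE J) (uniqE K)).
- exact: measurable_fun_process.
- exact: measurable_fun_process.
- by move=> _ [s [B [_ mB ->]]]; exact: measurable_cylinder.
move=> _ _ [s [B [us mB ->]]] [t [C [ut mC ->]]].
transitivity (\prod_(j <- s) P (Y (r j) @^-1` B j) *
  \prod_(k <- t) P (Y (q k) @^-1` C k)); last first.
  congr (_ * _); apply/esym.
    exact: (mutually_independent_reindex rI iY us mB).
  exact: (mutually_independent_reindex qI iY ut mC).
have := iYr (map inl s ++ map inr t)
  (fun x => match x with inl j => B j | inr k => C k end).
rewrite bigcap_seq !big_cat !big_map /= => <-.
- by rewrite -!bigcap_seq.
- rewrite cat_uniq !map_inj_uniq ?us ?ut//=; last 2 first.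
  + by move=> ? ? [].
  + by move=> ? ? [].
  rewrite andbT; apply/hasPn => _ /mapP[k _ ->].
  by apply/negP => /mapP[].
- by case.
Qed.

End one_space.
End joint_laws.

(** * Change of measure, sums over integer values, and products of i.i.d. factors *)

Section integrals.
Context (R : realType).
Local Open Scope ereal_scope.

(** The hypothesis says that [g] has the integrals of the Radon-Nikodym derivative between the two
    image laws, so it equals that derivative almost everywhere and the change of variables holds
    with [g]. *)
Lemma integral_density d (T : measurableType d) (P : probability T R)
    d' (T' : measurableType d') (Q : probability T' R)
    dU (U : measurableType dU) (X : T -> U) (Y : T' -> U) (g f : U -> \bar R) :
  measurable_fun [set: T] X -> measurable_fun [set: T'] Y ->
  measurable_fun [set: U] g -> (forall u, 0 <= g u) ->
  (forall B, measurable B ->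
     Q (Y @^-1` B) = \int[P]_(w in X @^-1` B) g (X w)) ->
  measurable_fun [set: U] f -> (forall u, 0 <= f u) ->
  \int[Q]_w f (Y w) = \int[P]_w (f (X w) * g (X w)).
Proof.
move=> mX mY mg g0 QE mf f0.
pose mu := distribution P (mfun_of mX).
pose nu := distribution Q (mfun_of mY).
have nuE B : measurable B -> nu B = \int[mu]_(u in B) g u.
  move=> mB; rewrite ge0_integral_pushforward//; first exact: QE.
  exact: measurable_funTS.
have numu : nu `<< mu.
  apply/null_content_dominatesP => B mB muB0; rewrite [LHS]nuE//.
  by apply: null_set_integral => //; exact: measurable_funTS.
pose h := Radon_Nikodym_SigmaFinite.f nu mu.
have ih : mu.-integrable setT h by exact: Radon_Nikodym_SigmaFinite.f_integrable.
have hg : ae_eq mu setT h g.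
  apply: integral_ae_eq => // E _ mE.
  by rewrite -nuE// -Radon_Nikodym_SigmaFinite.f_integral.
transitivity (\int[nu]_u f u); first by rewrite ge0_integral_pushforward.
rewrite -(Radon_Nikodym_SigmaFinite.change_of_variables numu)//.
transitivity (\int[mu]_u (f u * g u)).
  apply: ae_eq_integral => //.
  - by apply: emeasurable_funM => //; exact: measurable_int ih.
  - exact: emeasurable_funM.
  - by apply: filterS hg => u hgu _; congr (_ * _); exact: hgu.
rewrite ge0_integral_pushforward//; first exact: emeasurable_funM.
by move=> u _; exact: mule_ge0.
Qed.

Lemma integral_nat_valued d (T : measurableType d) (P : probability T R)
    (N : T -> nat) (f : nat -> \bar R) :
  measurable_fun [set: T] N -> (forall k, 0 <= f k) ->
  \int[P]_w f (N w) = \sum_(0 <= k <oo) P (N @^-1` [set k]) * f k.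
Proof.
move=> mN f0.
have mNk k : measurable (N @^-1` [set k]) by exact: preimage_measurable.
have NT : [set: T] = \bigcup_k (N @^-1` [set k]).
  by apply/seteqP; split => // w _; exists (N w).
rewrite NT ge0_integral_bigcup//.
- apply: eq_eseriesr => k _.
  rewrite (eq_integral (fun=> f k)); first by rewrite integral_cst// muleC.
  by move=> w; rewrite inE /= => ->.
- rewrite -NT.
  exact: (measurableT_comp (measurable_fun_nat f)).
- apply/trivIsetP => i j _ _ ij; apply/seteqP; split => // w [/= Ni Nj].
  by move: ij; rewrite -Ni -Nj eqxx.
Qed.

Lemma integral_prod_iid d (T : measurableType d) (P : probability T R)
    dU (U : measurableType dU) (Y : nat -> T -> U) :
  (forall i, measurable_fun [set: T] (Y i)) -> iid P Y ->
  forall n (g : nat -> U -> \bar R), (forall i, measurable_fun [set: U] (g i)) ->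
  (forall i u, 0 <= g i u) ->
  \int[P]_w (\prod_(i < n) g i (Y i w)) = \prod_(i < n) \int[P]_w g i (Y 0%N w).
Proof.
move=> mY iY; elim => [|n IH] g mg g0.
  under eq_integral do rewrite big_ord0.
  rewrite big_ord0 integral_cst// mul1e. exact: probability_setT.
under eq_integral do rewrite big_ord_recl.
have mYS : measurable_fun [set: T] ((fun w i => Y i.+1 w) : T -> process nat U).
  exact: measurable_fun_process.
have mYI : measurable_fun [set: T] ((fun w i => Y i w) : T -> process nat U).
  exact: measurable_fun_process.
(* The leading factor is viewed as a family indexed by [unit], so that splitting into disjoint
   blocks applies to it. *)
have mY0 : measurable_fun [set: T] ((fun w _ => Y 0%N w) : T -> process unit U).
  exact: measurable_fun_process.
pose G := (fun f => \prod_(i < n) g i.+1 (f i)) : process nat U -> \bar R.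
have mG : measurable_fun setT G.
  rewrite /G; elim: (n) => [|k IHk].
    rewrite [X in measurable_fun _ X](_ : _ = cst 1)//.
    by apply/funext => f; rewrite big_ord0.
  rewrite [X in measurable_fun _ X](_ : _ = (fun f : process nat U =>
    (\prod_(i < k) g i.+1 (f i)) * g k.+1 (f k))); last first.
    by apply/funext => f; rewrite big_ord_recr.
  apply: emeasurable_funM => //.
  apply: (measurableT_comp (mg _)).
  exact: (@measurable_fun_coordinate nat _ U).
have G0 f : 0 <= G f by apply: prode_ge0 => i _; exact: g0.
have ind : independent P ((fun w _ => Y 0%N w) : T -> process unit U)
    ((fun w i => Y i.+1 w) : T -> process nat U).
  apply: (@mutually_independent_split _ _ _ _ nat unit nat _ _ _
    (fun=> 0%N) succn) => //.
  - by move=> [] [].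
  - by move=> i j [].
  - exact: iY.1.
pose g1 := (fun f => g 0%N (f tt)) : process unit U -> \bar R.
have := @integral_independentM _ _ _ P _ _ _ _ _ _ g1 G mY0 mYS ind.
rewrite /g1 /G /= => ->//; last 1 first.
  by apply: (measurableT_comp (mg 0%N)); exact: (@measurable_fun_coordinate unit _ U tt).
rewrite big_ord_recl; congr (_ * _).
rewrite -(IH (fun i => g i.+1))//.
apply: (integral_same_law (f := G) mYS mYI) => //.
by apply: (@iid_reindex_same_law _ _ _ P nat nat _ _ _ succn id) => // i j [].
Qed.

End integrals.

(** * The process on path space *)

Section limits.
Context (R : realType).

(** Stating the Cauchy property with the countable scale 1/(k+1) and a single base point [N]
    exhibits the convergence set through countable operations, hence as a measurable set. *)
Lemma cvgn_cauchy (u : R^nat) : cvgn u <->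
  forall k, exists N, forall n, (N <= n)%N -> `|u N - u n| < k.+1%:R^-1.
Proof.
split=> [cu k|cu].
  have e0 : 0 < k.+1%:R^-1 / 2 :> R by rewrite divr_gt0.
  move/cvgrPdist_lt : cu => /(_ _ e0)[N _ Nu].
  exists N => n Nn; rewrite [ltRHS]splitr (le_lt_trans (ler_distD (limn u) _ _))//.
  rewrite ltrD//; last exact: Nu.
  by rewrite distrC; apply: Nu => /=.
apply/cauchy_cvgP; apply: cauchy_exP => e e0.
have [k ke] : exists k, k.+1%:R^-1 < e.
  exists (Num.truncn e^-1); rewrite invf_plt ?posrE//; exact: truncnS_gt.
have [N Nu] := cu k; exists (u N); exists N => // n /= Nn.
by rewrite /ball /=; apply: lt_trans ke; exact: Nu.
Qed.

(** For divergent sequences both sides are the default value of [limn], which is 0 in [R] and so is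
    fixed by scaling. This makes the restart identity for [V] hold at every point. *)
Lemma limnZl (c : R) (u : R^nat) : c != 0 ->
  limn (fun n => c * u n) = c * limn u.
Proof.
move=> c0; have [cu|ncu] := pselect (cvgn u).
  by apply/cvg_lim => //; exact: cvgMl_tmp.
rewrite (dvgP ncu) [LHS](dvgP _) ?mulr0//.
by apply: contra_not ncu; rewrite is_cvgMlE_tmp.
Qed.

Lemma limn_shiftS (u : R^nat) : limn (fun n => u n.+1) = limn u.
Proof.
have [cu|ncu] := pselect (cvgn u).
  by apply/cvg_lim => //; rewrite cvg_shiftS.
rewrite (dvgP ncu) [LHS](dvgP _)//.
apply: contra_not ncu => cu; apply/cvg_ex; exists (limn (fun n => u n.+1)).
by have : u n.+1 @[n --> \oo] --> limn (fun n => u n.+1) by []; rewrite cvg_shiftS.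
Qed.

(** On the measurable set of convergence this is a pointwise limit; off it [limn] is constant. *)
Lemma measurable_fun_limn d (T : measurableType d) (u : nat -> T -> R) :
  (forall n, measurable_fun [set: T] (u n)) ->
  measurable_fun [set: T] (fun w => limn (u ^~ w)).
Proof.
move=> mu; pose C := [set w | cvgn (u ^~ w)].
have mC : measurable C.
  rewrite [X in measurable X](_ : _ =
      \bigcap_k \bigcup_N \bigcap_(n in [set n | (N <= n)%N])
        [set w | `|u N w - u n w| < k.+1%:R^-1]).
    apply: bigcap_measurable => // k _; apply: bigcup_measurable => N _.
    apply: bigcap_measurable => [|n _]; first by exists N => /=.
    rewrite (_ : [set _ | _] = (fun w => `|u N w - u n w|) @^-1`
        [set` `]-oo, k.+1%:R^-1[]).
      apply: preimage_measurable => //.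
      by apply: measurableT_comp => //; exact: measurable_funB.
    by apply/seteqP; split => w /=; rewrite in_itv.
  apply/seteqP; split => w.
    by move=> /cvgn_cauchy cu k _; have [N Nu] := cu k; exists N.
  move=> cu; apply/cvgn_cauchy => k; have [N _ Nu] := cu k I.
  by exists N => n Nn; exact: Nu.
rewrite -(setUv C); apply/measurable_funU => //; first exact: measurableC.
split.
  apply: (measurable_fun_cvg (h := u)) => // n; exact: measurable_funTS.
apply: (eq_measurable_fun (fun=> point)) => //.
by move=> w; rewrite inE => nC; rewrite dvgP.
Qed.

End limits.

(** * The model on path space and its shift *)

Section canonical_data.
Context (R : realType) dS (S : measurableType dS).

Local Notation paths := (process nat S * process (nat * nat)%type nat)%type.

(* The model is instantiated on path space itself, so that its functionals can
   be evaluated at the shifted path. *)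
Definition canonical_offspring (n j : nat) (w : paths) : nat := w.2 (n, j).
Definition canonical_mark (n : nat) (w : paths) : S := w.1 n.

Lemma measurable_canonical_offspring n j :
  measurable_fun [set: paths] (canonical_offspring n j).
Proof.
exact: (measurableT_comp (@measurable_fun_coordinate (nat * nat)%type _ nat (n, j))
  measurable_snd).
Qed.

Lemma measurable_canonical_mark n :
  measurable_fun [set: paths] (canonical_mark n).
Proof.
exact: (measurableT_comp (@measurable_fun_coordinate nat _ S n) measurable_fst).
Qed.

(** The functionals A, B, C of a mark are those of [Z]; only the random inputs are replaced by the
    coordinates of the path. *)
Definition canonical_data d (T : measurableType d) (Z : branching_data T S) :
    branching_data paths S :=
  BranchingData (fun n j => mfun_of (measurable_canonical_offspring n j))
    (fun n => mfun_of (measurable_canonical_mark n)) (mark_B Z)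
    (mark_A_gt0 Z) (mark_C0 Z).

Definition shift_paths (w : paths) : paths :=
  ((fun n => w.1 n.+1), (fun nj => w.2 (nj.1.+1, nj.2))).

Lemma measurable_shift_paths : measurable_fun [set: paths] shift_paths.
Proof.
apply: measurable_fun_pair; apply: measurable_fun_process => i.
  exact: measurable_canonical_mark.
exact: measurable_canonical_offspring.
Qed.

Section data.
Context d (T : measurableType d) (Z : branching_data T S).

Definition history (w : T) : paths := (marks Z w, offspring_array Z w).

Lemma measurable_marks : measurable_fun [set: T] (marks Z).
Proof. by apply: measurable_fun_process => i; exact: measurable_funP. Qed.

Lemma measurable_offspring_array : measurable_fun [set: T] (offspring_array Z).
Proof. by apply: measurable_fun_process => i; exact: measurable_funP. Qed.

Lemma measurable_history : measurable_fun [set: T] history.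
Proof. exact: measurable_fun_pair measurable_marks measurable_offspring_array. Qed.

(** This is [Psi] at generation 0 as a function of the first mark and the first offspring row alone,
    the form needed to exploit their independence of the shifted path. *)
Definition progeny (h : S * process nat nat) (k : nat) : nat :=
  (\sum_(j < mark_A Z h.1 * mark_C Z k h.1 + mark_B Z h.1) h.2 j)%N.

Definition first_row (w : T) : process nat nat := fun j => offspring Z 0 j w.

Lemma measurable_first_row : measurable_fun [set: T] first_row.
Proof. by apply: measurable_fun_process => i; exact: measurable_funP. Qed.

Lemma measurable_progeny k :
  measurable_fun [set: S * process nat nat] (progeny ^~ k).
Proof.
apply: (measurable_fun_nat_bind
  (N := fun h : S * process nat nat => (mark_A Z h.1 * mark_C Z k h.1 + mark_B Z h.1)%N)
  (F := fun n (h : S * process nat nat) => (\sum_(j < n) h.2 j)%N)).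
  apply: measurable_fun_addn; last exact: measurableT_comp.
  by apply: measurable_fun_muln; exact: measurableT_comp.
move=> n.
apply: (measurable_fun_sumn (f := fun j (h : S * process nat nat) => h.2 j)) => j.
exact: (measurableT_comp (@measurable_fun_coordinate nat _ nat j) measurable_snd).
Qed.

Lemma measurable_Psi n k : measurable_fun [set: T] (Psi Z n k).
Proof.
apply: (measurable_fun_nat_bind
  (N := fun w => (mark_A Z (mark Z n w) * mark_C Z k (mark Z n w) +
           mark_B Z (mark Z n w))%N)
  (F := fun i w => (\sum_(j < i) offspring Z n j w)%N)).
  apply: measurable_fun_addn; last exact: measurableT_comp.
  by apply: measurable_fun_muln; exact: measurableT_comp.
move=> i.
apply: (measurable_fun_sumn (f := fun j w => offspring Z n j w)) => j.
exact: measurable_funP.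
Qed.

Lemma measurable_X x n : measurable_fun [set: T] (X Z x n).
Proof.
elim: n => [|n IH]; first exact: measurable_cst.
apply: (measurable_fun_nat_bind (F := Psi Z n)) => // k.
exact: measurable_Psi.
Qed.

Variables (m lambda : R).

(* [f] need not be measurable on [R]: [M] takes countably many values. *)
Lemma measurable_fun_M n dU (U : measurableType dU) (f : R -> U) :
  measurable_fun [set: T] (fun w => f (M Z m lambda n w)).
Proof.
apply: (measurableT_comp (f := fun k : nat => f (m * lambda * k%:R))).
  exact: measurable_fun_nat.
exact: measurableT_comp.
Qed.

Lemma measurable_fun_X x n dU (U : measurableType dU) (f : nat -> U) :
  measurable_fun [set: T] (fun w => f (X Z x n w)).
Proof. exact: (measurableT_comp (measurable_fun_nat f) (measurable_X x n)). Qed.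

Definition W (x n : nat) (w : T) : R := (X Z x n w)%:R / Delta Z m lambda n w.

Lemma measurable_W x n : measurable_fun [set: T] (W x n).
Proof.
apply: measurable_funM; first exact: measurable_fun_X.
rewrite [X in measurable_fun _ X](_ : _ =
  fun w => \prod_(j < n) (M Z m lambda j w)^-1).
  by apply: measurable_prod => i _; exact: measurable_fun_M.
by apply/funext => w; rewrite /Delta prodfV.
Qed.

Lemma measurable_V x : measurable_fun [set: T] (V Z m lambda x).
Proof. exact/measurable_fun_limn/measurable_W. Qed.

Lemma measurable_V_process : measurable_fun [set: T] (V_process Z m lambda).
Proof. by apply: measurable_fun_process => x; exact: measurable_V. Qed.

Lemma measurable_M_Psi : measurable_fun [set: T] (M_Psi Z m lambda).
Proof.
apply: measurable_fun_pair; first exact: (measurable_fun_M 0 id).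
by apply: measurable_fun_process => k; exact: measurable_Psi.
Qed.

End data.

Section restart.
Context d (T : measurableType d) (Z : branching_data T S).
Variables (m lambda : R).
Local Notation cZ := (canonical_data Z).

Lemma X_history x n w : X cZ x n (history Z w) = X Z x n w.
Proof. by elim: n => //= n ->. Qed.

Lemma W_history x n w : W cZ m lambda x n (history Z w) = W Z m lambda x n w.
Proof. by rewrite /W X_history. Qed.

Lemma V_history x w : V cZ m lambda x (history Z w) = V Z m lambda x w.
Proof.
by rewrite /V; congr (limn _); apply/funext => n; exact: W_history.
Qed.

(** Running one step and then the remaining generations from the new state is an identity between
    paths, with no probability involved. *)
Lemma X_shift x n w : X cZ x n.+1 w = X cZ (Psi cZ 0 x w) n (shift_paths w).
Proof. by elim: n => //= n ->. Qed.

Lemma Delta_shift n w : Delta cZ m lambda n.+1 w =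
  M cZ m lambda 0 w * Delta cZ m lambda n (shift_paths w).
Proof. by rewrite /Delta big_ord_recl. Qed.

Lemma W_shift x n w : W cZ m lambda x n.+1 w =
  (M cZ m lambda 0 w)^-1 * W cZ m lambda (Psi cZ 0 x w) n (shift_paths w).
Proof. by rewrite /W X_shift Delta_shift invfM mulrCA. Qed.

End restart.
End canonical_data.

(** * Independence of the first generation and stationarity of the shifted path *)

Section restart_laws.
Context (R : realType) d (T : measurableType d) dS (S : measurableType dS).
Variables (Z : branching_data T S) (Q : probability T R).
Hypothesis hQ : iid_environment_and_offspring Z Q.
Local Open Scope ereal_scope.

Local Notation paths := (process nat S * process (nat * nat)%type nat)%type.

(** Marks and offspring are each split into generation 0 and the rest; their mutual independence
    then allows the pieces to be regrouped by generation. *)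
Lemma independent_head_shift :
  independent Q (fun w => (mark Z 0 w, first_row Z w))
    (fun w => shift_paths (history Z w)).
Proof.
have [iM iO iMO] := hQ.
apply: (independent_pairs (X1 := mark Z 0) (X2 := first_row Z)
  (Y1 := (fun w => (shift_paths (history Z w)).1) : T -> process nat S)
  (Y2 := (fun w => (shift_paths (history Z w)).2) : T -> process (nat * nat)%type nat)).
- exact: measurable_funP.
- exact: measurable_first_row.
- exact: (measurableT_comp measurable_fst
    (measurableT_comp (@measurable_shift_paths _ S) (measurable_history Z))).
- exact: (measurableT_comp measurable_snd
    (measurableT_comp (@measurable_shift_paths _ S) (measurable_history Z))).
- have h : independent Q ((fun w _ => mark Z 0 w) : T -> process unit S)
      ((fun w i => mark Z i.+1 w) : T -> process nat S).
    apply: (@mutually_independent_split _ _ _ Q nat unit nat _ _ (mark Z)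
      (fun=> 0%N) succn) => //; [by move=> [] []|by move=> i j []|exact: iM.1].
  move=> A B mA mB.
  apply: (h ((fun f : process unit S => f tt) @^-1` A) B) => //.
  exact: (preimage_measurable (@measurable_fun_coordinate unit _ S tt)).
- apply: (@mutually_independent_split _ _ _ Q (nat * nat)%type nat (nat * nat)%type
    _ _ (fun nj => offspring Z nj.1 nj.2)
    (fun j => (0%N, j)) (fun nj => (nj.1.+1, nj.2))) => //.
  + by move=> j k [].
  + by move=> [i j] [k l] [-> ->].
  + exact: iO.1.
- apply: (independent_comp
    (f := (fun f => (f 0%N, fun n => f n.+1)) : process nat S -> S * process nat S)
    (g := (fun f => (fun j => f (0%N, j), fun nj => f (nj.1.+1, nj.2))) :
      process (nat * nat)%type nat ->
      process nat nat * process (nat * nat)%type nat) _ _ iMO).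
  + apply: measurable_fun_pair; first exact: (@measurable_fun_coordinate nat _ S).
    exact: (@measurable_fun_reindex nat nat _ S).
  + apply: measurable_fun_pair.
      exact: (@measurable_fun_reindex (nat * nat)%type nat _ nat).
    exact: (@measurable_fun_reindex (nat * nat)%type (nat * nat)%type _ nat).
Qed.

Lemma same_law_shift :
  same_law Q (fun w => shift_paths (history Z w)) Q (history Z).
Proof.
have [iM iO iMO] := hQ.
have mmS : measurable_fun [set: T]
    ((fun w => (shift_paths (history Z w)).1) : T -> process nat S).
  exact: (measurableT_comp measurable_fst
    (measurableT_comp (@measurable_shift_paths _ S) (measurable_history Z))).
have moS : measurable_fun [set: T]
    ((fun w => (shift_paths (history Z w)).2) : T -> process (nat * nat)%type nat).
  exact: (measurableT_comp measurable_snd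
    (measurableT_comp (@measurable_shift_paths _ S) (measurable_history Z))).
apply: (same_law_pair mmS moS (measurable_marks Z) (measurable_offspring_array Z)).
- apply: (independent_comp
    (f := (fun f => fun n => f n.+1) : process nat S -> process nat S)
    (g := (fun f => fun nj => f (nj.1.+1, nj.2)) :
      process (nat * nat)%type nat -> process (nat * nat)%type nat) _ _ iMO).
    exact: (@measurable_fun_reindex nat nat _ S).
  exact: (@measurable_fun_reindex (nat * nat)%type (nat * nat)%type _ nat).
- exact: iMO.
- by apply: (@iid_reindex_same_law _ _ _ Q nat nat _ _ (mark Z) succn id) => // i j [].
- apply: (@iid_reindex_same_law _ _ _ Q (nat * nat)%type (nat * nat)%type _ _
    (fun nj => offspring Z nj.1 nj.2) (fun nj => (nj.1.+1, nj.2))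
    (fun nj => (nj.1, nj.2))) => //.
  + by move=> [i j] [k l] [-> ->].
  + by move=> [i j] [k l] [-> ->].
Qed.

(** This is the Markov property at time 1: given the first generation, the shifted path may be
    replaced by an independent copy of the whole history. The weight [g] leaves room for a power of
    the first M. *)
Lemma integral_restart (g : S -> \bar R) (F : paths -> nat -> \bar R) x :
  measurable_fun [set: S] g -> (forall s, 0 <= g s) ->
  (forall k, measurable_fun [set: paths] (F ^~ k)) -> (forall w k, 0 <= F w k) ->
  \int[Q]_w (g (mark Z 0 w) * F (shift_paths (history Z w)) (Psi Z 0 x w)) =
  \int[Q]_w (g (mark Z 0 w) * \int[Q]_w' F (history Z w') (Psi Z 0 x w)).
Proof.
move=> mg g0 mF F0.
pose G (z : (S * process nat nat) * paths) : \bar R :=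
  g z.1.1 * F z.2 (progeny Z z.1 x).
have mG : measurable_fun setT G.
  apply: emeasurable_funM.
    exact: (measurableT_comp mg (measurableT_comp measurable_fst measurable_fst)).
  apply: (measurable_fun_nat_bind
    (N := fun z : (S * process nat nat) * paths => progeny Z z.1 x)
    (F := fun k (z : (S * process nat nat) * paths) => F z.2 k)).
    exact: (measurableT_comp (measurable_progeny Z x) measurable_fst).
  by move=> k; exact: (measurableT_comp (mF k) measurable_snd).
have mh : measurable_fun [set: T] (fun w => (mark Z 0 w, first_row Z w)).
  by apply: measurable_fun_pair => //; exact: measurable_first_row.
have msh : measurable_fun [set: T] (fun w => shift_paths (history Z w)).
  exact: (measurableT_comp (@measurable_shift_paths _ S) (measurable_history Z)).
have := integral_independent mh msh (measurable_history Z)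
  independent_head_shift same_law_shift mG.
rewrite /G /= => ->; last by move=> z; exact: mule_ge0.
apply: eq_integral => w _; rewrite ge0_integralZl//.
exact: (measurableT_comp (mF _) (measurable_history Z)).
Qed.

End restart_laws.

Section restart_V.
Context (R : realType) d (T : measurableType d) dS (S : measurableType dS).
Variables (Z : branching_data T S) (m lambda : R).
Hypotheses (m_gt0 : 0 < m) (lambda_gt0 : 0 < lambda).
Local Notation cZ := (canonical_data Z).

Lemma M_gt0 n w : 0 < M Z m lambda n w.
Proof. by rewrite /M mulr_gt0 ?mulr_gt0// ltr0n mark_A_gt0. Qed.

Lemma Delta_gt0 n w : 0 < Delta Z m lambda n w.
Proof. by apply: prodr_gt0 => i _; exact: M_gt0. Qed.

Lemma W_ge0 x n w : 0 <= W Z m lambda x n w.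
Proof. by rewrite divr_ge0// ltW// Delta_gt0. Qed.

Lemma V_ge0 x w : 0 <= V Z m lambda x w.
Proof.
change (0 <= limn (fun n => W Z m lambda x n w)).
have [cu|ncu] := pselect (cvgn (fun n => W Z m lambda x n w)).
  by apply: limr_ge => //; apply: nearW => n; exact: W_ge0.
by rewrite (dvgP ncu).
Qed.

(** The factor 1/M_0 leaves the limit and the index is shifted; both moves are valid without
    convergence, so no null set enters the distributional equation. *)
Lemma V_restart x w : V Z m lambda x w = (M Z m lambda 0 w)^-1 *
  V cZ m lambda (Psi Z 0 x w) (shift_paths (history Z w)).
Proof.
rewrite -[LHS]V_history /V -[LHS]limn_shiftS -limnZl ?invr_neq0 ?gt_eqF ?M_gt0//.
congr (limn _); apply/funext => n.
exact: W_shift.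
Qed.

End restart_V.

(** * The tilted law *)

Section tilting.
Context (R : realType) d (T : measurableType d) dS (S : measurableType dS).
Variables (Z : branching_data T S) (P Pa : probability T R) (m lambda alpha : R).
Hypotheses (m_gt0 : 0 < m) (lambda_gt0 : 0 < lambda).
Hypothesis hZ : iid_environment_and_offspring Z P.
Hypothesis hPa : tilted_law Z m lambda P alpha Pa.
Local Notation L := (Lambda Z m lambda P alpha).

(** The density contributed by a single mark; the density on n marks is the product of these
    factors. *)
Definition tilt (s : S) : R :=
  (m * lambda * (mark_A Z s)%:R) `^ alpha * expR (- L).

Lemma tilt_ge0 s : 0 <= tilt s.
Proof. by rewrite mulr_ge0 ?powR_ge0 ?expR_ge0. Qed.

Lemma measurable_fun_mark_A dU (U : measurableType dU) (f : nat -> U) :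
  measurable_fun [set: S] (fun s => f (mark_A Z s)).
Proof. exact: (measurableT_comp (measurable_fun_nat f) (measurable_funP _)). Qed.

Lemma measurable_tilt : measurable_fun [set: S] tilt.
Proof.
exact: (measurable_fun_mark_A
  (fun k => (m * lambda * k%:R) `^ alpha * expR (- L))).
Qed.

Lemma DeltaS n w :
  Delta Z m lambda n.+1 w = Delta Z m lambda n w * M Z m lambda n w.
Proof. by rewrite /Delta big_ord_recr. Qed.

Lemma Delta_tilt n w :
  Delta Z m lambda n w `^ alpha * expR (- n%:R * L) =
  \prod_(i < n) tilt (mark Z i w).
Proof.
elim: n => [|n IH].
  by rewrite /Delta !big_ord0 powR1 mul1r oppr0 mul0r expR0.
rewrite big_ord_recr /= -IH DeltaS powRM; last 2 first.
- exact/ltW/Delta_gt0.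
- exact/ltW/M_gt0.
rewrite -addn1 natrD mulNr mulrDl mul1r opprD expRD -mulNr /tilt.
by rewrite mulrACA.
Qed.

Local Open Scope ereal_scope.

(** This will be the law of each mark under [Pa]. The indicator sits in the integrand so that an
    event on n marks becomes a product of n functions of one mark. *)
Definition tilted_mark (B : set S) : \bar R :=
  \int[P]_w ((\1_B (mark Z 0 w) * tilt (mark Z 0 w))%R)%:E.

Lemma tilted_markE B : measurable B -> tilted_mark B =
  \int[P]_(w in mark Z 0 @^-1` B) (tilt (mark Z 0 w))%:E.
Proof.
move=> mB; rewrite [RHS]integral_mkcond; apply: eq_integral => w _.
rewrite patchE indicE; case: ifPn; rewrite ?inE ?notin_setE /= => wB.
  by rewrite mem_set// mul1r.
by rewrite memNset// mul0r.
Qed.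

(** A product density over i.i.d. marks keeps them independent: the integral over a rectangle
    factors. *)
Lemma tilted_prefix n (B : nat -> set S) : (forall i, measurable (B i)) ->
  Pa (\bigcap_(i in [set i | (i < n)%N]) mark Z i @^-1` B i) =
  \prod_(i < n) tilted_mark (B i).
Proof.
move=> mB; have [hn _ _] := hPa.
pose A : set (process 'I_n S) := cylinder (enum 'I_n) (fun i => B i).
have mA : measurable A by apply: measurable_cylinder.
have AE : \bigcap_(i in [set i | (i < n)%N]) mark Z i @^-1` B i =
    (@first_marks _ _ _ _ Z n) @^-1` A.
  apply/seteqP; split => w h i /=; first by move=> _; apply: h => /=.
  by move=> ilt; apply: (h (Ordinal ilt)); rewrite /= mem_enum.
rewrite AE hn//.
pose g i s := ((\1_(B i) s * tilt s)%R)%:E.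
transitivity (\int[P]_w \prod_(i < n) g i (mark Z i w)).
  rewrite integral_mkcond; apply: eq_integral => w _; rewrite patchE.
  case: ifPn; rewrite ?inE ?notin_setE -AE /= => wA.
    rewrite Delta_tilt -prodEFin; apply: eq_bigr => i _.
    by rewrite /g indicE mem_set ?mul1r//; apply: wA => /=.
  have [i [ilt niB]] : exists i, (i < n)%N /\ ~ B i (mark Z i w).
    apply: contrapT => /forallNP h; apply: wA => i /= ilt.
    by apply: contrapT => nB; apply: (h i).
  rewrite (bigD1 (Ordinal ilt))//= {1}/g indicE memNset//.
  by rewrite mul0r mul0e.
have [iM _ _] := hZ.
have := integral_prod_iid (fun i => measurable_funP (mark Z i)) iM n (g := g).
apply.
- move=> i; apply/measurable_EFinP; apply: measurable_funM.
    exact: measurable_indic.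
  exact: measurable_tilt.
- by move=> i s; rewrite lee_fin mulr_ge0// tilt_ge0.
Qed.

Lemma tilted_mark1 B : measurable B -> Pa (mark Z 0 @^-1` B) = tilted_mark B.
Proof.
move=> mB; have := @tilted_prefix 1 (fun=> B) (fun=> mB).
rewrite big_ord_recl big_ord0 mule1 => <-; congr (Pa _).
apply/seteqP; split => w /=; first by move=> h [|i].
by move=> /(_ 0%N); exact.
Qed.

Lemma tilted_markT : tilted_mark setT = 1.
Proof. by rewrite -tilted_mark1// preimage_setT; exact: probability_setT. Qed.

Lemma tilted_cylinder s (B : nat -> set S) : uniq s ->
  (forall i, measurable (B i)) ->
  Pa (\bigcap_(i in [set` s]) mark Z i @^-1` B i) =
  \prod_(i <- s) tilted_mark (B i).
Proof.
move=> us mB.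
(* A prefix long enough to contain all the indices of [s]; the missing ones get the full set, which
   contributes the factor 1. *)
pose n := (\max_(i <- s) i).+1.
have sn i : i \in s -> (i < n)%N by move=> si; rewrite ltnS; exact: leq_bigmax_seq.
pose B' i := if i \in s then B i else setT.
have := @tilted_prefix n B'.
rewrite (_ : \bigcap_(i in [set i | (i < n)%N]) _ =
    \bigcap_(i in [set` s]) mark Z i @^-1` B i).
  move=> ->; last by move=> i; rewrite /B'; case: ifP.
  rewrite -(big_mkord xpredT (fun i => tilted_mark (B' i))).
  rewrite (eq_bigr (fun i => if i \in s then tilted_mark (B i) else 1)); last first.
    by move=> i _; rewrite /B'; case: ifP => // _; exact: tilted_markT.
  rewrite -big_mkcond/= -big_filter; apply: perm_big.
  apply: uniq_perm => //; first by rewrite filter_uniq// iota_uniq.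
  move=> i; rewrite mem_filter mem_index_iota /=.
  by case si : (i \in s) => //=; exact: sn.
apply/seteqP; split => w h i /= hi.
  by have := h i (sn _ hi); rewrite /B' hi.
by rewrite /B'; case: ifPn => // si; exact: h.
Qed.

(** The standing assumptions survive the tilt, so all restart results apply with [Pa] in place of
    [P]. *)
Lemma tilted_iid : iid_environment_and_offspring Z Pa.
Proof.
have [hn ind law] := hPa; have [iM [iO lO] iMO] := hZ.
have mark1 i B : measurable B -> Pa (mark Z i @^-1` B) = tilted_mark B.
  move=> mB; have := @tilted_cylinder [:: i] (fun=> B) isT (fun=> mB).
  by rewrite big_seq1 bigcap_seq big_seq1.
split=> //.
  split.
    move=> s B us mB; rewrite tilted_cylinder//.
    by apply: eq_bigr => i _; rewrite mark1.
  by move=> i j B mB; rewrite !mark1.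
have off1 (A : set (process (nat * nat)%type nat)) : measurable A ->
    Pa (offspring_array Z @^-1` A) = P (offspring_array Z @^-1` A).
  exact: law.
have coord (nj : nat * nat) B : measurable B ->
    Pa (offspring Z nj.1 nj.2 @^-1` B) = P (offspring Z nj.1 nj.2 @^-1` B).
  move=> mB.
  apply: (off1 ((fun f : process (nat * nat)%type nat => f nj) @^-1` B)).
  exact: (preimage_measurable (@measurable_fun_coordinate _ _ nat nj)).
split.
  move=> s B us mB.
  transitivity (P (\bigcap_(i in [set` s]) offspring Z i.1 i.2 @^-1` B i)).
    exact: (off1 (cylinder s B) (measurable_cylinder s mB)).
  by rewrite iO//; apply: eq_bigr => i _; rewrite coord.
by move=> i j B mB; rewrite !coord//; exact: lO.
Qed.

(** The weight M^(-alpha) cancels the factor M^alpha of the density of the first mark and leaves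
    e^(-L). The functional may involve the first offspring row because, given the mark, that row has
    the same law under both measures. *)
Lemma integral_tilted_first (phi : S * process nat nat -> \bar R) :
  measurable_fun setT phi -> (forall h, 0 <= phi h) ->
  \int[Pa]_w ((M Z m lambda 0 w `^ (- alpha))%R%:E *
    phi (mark Z 0 w, first_row Z w)) =
  (expR (- L))%:E * \int[P]_w phi (mark Z 0 w, first_row Z w).
Proof.
move=> mphi phi0; have [_ ind law] := hPa; have [_ _ iMO] := hZ.
have head_row (Q : probability T R) : independent Q (marks Z) (offspring_array Z) ->
    independent Q (mark Z 0) (first_row Z).
  move=> h A B mA mB.
  apply: (h ((fun f : process nat S => f 0%N) @^-1` A)
    ((fun f : process (nat * nat)%type nat => (fun j => f (0%N, j)) : process nat nat)
      @^-1` B)).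
    exact: (preimage_measurable (@measurable_fun_coordinate nat _ S 0%N)).
  apply: preimage_measurable => //.
  exact: (@measurable_fun_reindex (nat * nat)%type nat _ nat).
have rlaw : same_law Pa (first_row Z) P (first_row Z).
  move=> B mB.
  apply: (law ((fun f : process (nat * nat)%type nat =>
    (fun j => f (0%N, j)) : process nat nat) @^-1` B)).
  apply: preimage_measurable => //.
  exact: (@measurable_fun_reindex (nat * nat)%type nat _ nat).
pose H s := \int[P]_w phi (s, first_row Z w).
have mH : measurable_fun setT H.
  by apply: (measurable_fun_partial_integral P (measurable_first_row Z) mphi).
have H0 s : 0 <= H s by exact: integral_ge0.
pose q s : R := ((m * lambda * (mark_A Z s)%:R) `^ (- alpha))%R.
have mq : measurable_fun setT q.
  exact: (measurable_fun_mark_A (fun k => (m * lambda * k%:R) `^ (- alpha))%R).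
have q0 s : (0 <= (q s)%:E) by rewrite lee_fin powR_ge0.
(* The row is integrated out first, already under [P]; then only the law of the mark remains to be
   changed. *)
transitivity (\int[Pa]_w ((q (mark Z 0 w))%:E * H (mark Z 0 w))).
  have := integral_independent (measurable_funP (mark Z 0))
    (measurable_first_row Z) (measurable_first_row Z) (head_row _ ind) rlaw
    (F := fun h => (q h.1)%:E * phi h).
  rewrite /= => ->.
  - apply: eq_integral => w _; rewrite ge0_integralZl//.
    exact: (measurableT_comp mphi (measurable_fun_pair _ (measurable_first_row Z))).
  - apply: emeasurable_funM => //.
    apply/measurable_EFinP; exact: (measurableT_comp mq measurable_fst).
  - by move=> z; exact: mule_ge0.
transitivity (\int[P]_w ((expR (- L))%:E * H (mark Z 0 w))).
  have tiltE (B : set S) : measurable B -> Pa (mark Z 0 @^-1` B) =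
      \int[P]_(w in mark Z 0 @^-1` B) (tilt (mark Z 0 w))%:E.
    by move=> mB; rewrite tilted_mark1// tilted_markE.
  have := integral_density (measurable_funP (mark Z 0)) (measurable_funP (mark Z 0))
    (g := fun s => (tilt s)%:E) (f := fun s => (q s)%:E * H s) _ _ tiltE.
  move=> ->.
  - apply: eq_integral => w _; rewrite muleAC -EFinM; congr (_%:E * _).
    rewrite /tilt /q mulrA -powRD.
      by rewrite addNr powRr0 mul1r.
    by apply/implyP => _; rewrite gt_eqF// (M_gt0 Z m_gt0 lambda_gt0 0 w).
  - exact/measurable_EFinP/measurable_tilt.
  - by move=> s; rewrite lee_fin tilt_ge0.
  - by apply: emeasurable_funM => //; exact/measurable_EFinP.
  - by move=> s; exact: mule_ge0.
rewrite ge0_integralZl//; last exact: measurableT_comp.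
congr (_ * _).
have := integral_independent (measurable_funP (mark Z 0))
  (measurable_first_row Z) (measurable_first_row Z) (head_row _ iMO)
  (fun A mA => erefl) mphi (fun=> phi0 _).
by move=> /= <-.
Qed.

End tilting.

(** * Moment estimates *)

Section powers.
Context (R : realType).

Lemma powR_inv (a r : R) : (0 <= a)%R -> (a^-1 `^ r = a `^ (- r))%R.
Proof. by move=> a0; rewrite -(powR_inv1 a0) -powRrM mulN1r. Qed.

(** Below the scale [t] the first term suffices; above it the ratio exceeds 1 and its exponent may
    be raised from beta to alpha. The scale is kept free so that it can follow the growth of X_n. *)
Lemma powR_le_interpolate (alpha beta t y : R) : 0 <= beta -> beta < alpha ->
  0 < t -> 0 <= y -> y `^ beta <= t `^ beta * (1 + (y / t) `^ alpha).
Proof.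
move=> b0 ba t0 y0; have [yt|ty] := leP y t.
  apply: (@le_trans _ _ (t `^ beta)).
    by apply: ge0_ler_powR => //; rewrite nnegrE ltW.
  by rewrite ler_peMr ?powR_ge0// lerDl powR_ge0.
have yE : y = t * (y / t) by rewrite mulrCA divff ?gt_eqF// mulr1.
have yt1 : 1 <= y / t by rewrite ler_pdivlMr// mul1r ltW.
rewrite {1}yE powRM ?(ltW t0)// ?(le_trans _ yt1)//.
apply: ler_wpM2l; first exact: powR_ge0.
apply: (@le_trans _ _ ((y / t) `^ alpha)); last by rewrite lerDr ler01.
by rewrite ler_powR// ltW.
Qed.

(** A substitute for Minkowski and for subadditivity that treats all alpha > 0 at once. The point is
    that [b] may be taken arbitrarily close to 1, at the price of a large [K]. *)
Lemma powR_add_le (alpha b : R) : 0 < alpha -> 1 < b ->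
  exists2 K : R, 0 <= K & forall a c, 0 <= a -> 0 <= c ->
    (a + c) `^ alpha <= b * a `^ alpha + K * c `^ alpha.
Proof.
move=> al0 b1; pose l := b `^ alpha^-1.
have b0 : 0 < b by exact: lt_trans b1.
have l0 : 0 < l by exact: powR_gt0.
have lal : l `^ alpha = b by rewrite -powRrM mulVf ?gt_eqF// powRr1// ltW.
have l1 : 1 < l.
  rewrite ltNge; apply/negP => l1.
  have : l `^ alpha <= 1 `^ alpha.
    by apply: ge0_ler_powR => //; rewrite ?nnegrE ?(ltW l0) ?(ltW al0).
  by rewrite lal powR1 leNgt b1.
(* a + c <= max (l a) (l' c) when 1/l + 1/l' = 1 *)
pose l' := l / (l - 1).
have l'0 : 0 <= l' by rewrite divr_ge0 ?ltW// subr_gt0.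
exists (l' `^ alpha); first exact: powR_ge0.
move=> a c a0 c0; have [h|h] := leP (c) ((l - 1) * a).
  apply: (@le_trans _ _ ((l * a) `^ alpha)).
    apply: ge0_ler_powR; rewrite ?nnegrE ?(ltW al0) ?addr_ge0// ?mulr_ge0 ?(ltW l0)//.
    by rewrite -lerBrDl (le_trans h)// mulrBl mul1r.
  by rewrite powRM ?(ltW l0)// lal lerDl mulr_ge0 ?powR_ge0.
apply: (@le_trans _ _ ((l' * c) `^ alpha)).
  apply: ge0_ler_powR; rewrite ?nnegrE ?(ltW al0) ?(mulr_ge0 l'0 c0) ?addr_ge0//.
  have l10 : 0 < l - 1 by rewrite subr_gt0.
  have -> : l' * c = c / (l - 1) + c.
    by rewrite /l'; field; rewrite gt_eqF.
  by rewrite lerD2r ler_pdivlMr// mulrC ltW.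
by rewrite powRM// lerDr mulr_ge0 ?powR_ge0// ltW.
Qed.

(** Taking roots of order alpha bounds the increments by a geometric sequence of ratio p^(1/alpha) <
    1. The constant depends on neither the sequence nor [z], so the bound can be integrated over
    random sequences. *)
Lemma powR_increments_cvg (alpha p : R) : 0 < alpha -> 0 < p -> p < 1 ->
  exists2 K : R, 0 <= K & forall (u : R^nat) (z : R), (forall n, 0 <= u n) ->
    0 <= z -> (forall n, `|u n.+1 - u n| `^ alpha <= z * p ^+ n) ->
    cvgn u /\ forall n, u n `^ alpha <= K * (u 0%N `^ alpha + z).
Proof.
move=> al0 p0 p1; pose s := p `^ alpha^-1.
have s0 : 0 < s by exact: powR_gt0.
have salpha : s `^ alpha = p by rewrite -powRrM mulVf ?gt_eqF// powRr1// ltW.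
have s1 : s < 1.
  rewrite ltNge; apply/negP => s1.
  have : 1 `^ alpha <= s `^ alpha.
    by apply: ge0_ler_powR => //; rewrite ?nnegrE ?(ltW s0) ?(ltW al0).
  by rewrite salpha powR1 leNgt p1.
have [K K0 Kle] := powR_add_le al0 (ltr1n R 2).
(* The sequence stays below u_0 + y/(1 - s); the power of this sum is split with b = 2. *)
exists (2 + K * ((1 - s)^-1) `^ alpha).
  by rewrite addr_ge0// mulr_ge0// powR_ge0.
move=> u z u0 z0 uz; pose y := z `^ alpha^-1.
have y0 : 0 <= y by exact: powR_ge0.
have yal : y `^ alpha = z by rewrite -powRrM mulVf ?gt_eqF// powRr1.
have uy n : `|u n.+1 - u n| <= geometric y s n.
  rewrite /geometric /= leNgt; apply/negP => h.
  have := uz n; rewrite leNgt => /negP; apply.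
  have -> : z * p ^+ n = (y * s ^+ n) `^ alpha.
    rewrite powRM ?exprn_ge0 ?(ltW s0)// yal; congr (_ * _).
    by rewrite -(powR_mulrn n (ltW s0)) -powRrM mulrC powRrM salpha powR_mulrn// ltW.
  by apply: gt0_ltr_powR; rewrite ?nnegrE ?mulr_ge0 ?exprn_ge0 ?(ltW s0).
have cg : cvgn (series (geometric y s)).
  by apply: is_cvg_geometric_series; rewrite ger0_norm ?ltW.
have g0 n : 0 <= geometric y s n by rewrite mulr_ge0 ?exprn_ge0 ?(ltW s0).
split.
  have ct : cvgn (series (telescope u)).
    by apply: normed_cvg; exact: (series_le_cvg _ g0 uy cg).
  rewrite (_ : u = fun n => u 0%N + series (telescope u) n).
    by apply: is_cvgD => //; exact: is_cvg_cst.
  by apply/funext => n; rewrite -eq_sum_telescope.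
move=> n; have un : u n <= u 0%N + y / (1 - s).
  rewrite eq_sum_telescope lerD2l.
  apply: (@le_trans _ _ (series (geometric y s) n)).
    apply: ler_sum => i _; exact: (le_trans (ler_norm _) (uy i)).
  rewrite geometric_seriesE ?lt_eqF//= ler_wpM2r ?invr_ge0 ?subr_ge0 ?(ltW s1)//.
  by rewrite ler_piMr// lerBlDr lerDl exprn_ge0 ?(ltW s0).
apply: (@le_trans _ _ ((u 0%N + y / (1 - s)) `^ alpha)).
  by apply: ge0_ler_powR; rewrite ?nnegrE ?(ltW al0) ?(le_trans (u0 n)).
have i0 : 0 <= (1 - s)^-1 by rewrite invr_ge0 subr_ge0 ltW.
apply: (le_trans (Kle _ _ (u0 _) (mulr_ge0 y0 i0))).
rewrite powRM// yal mulrDr lerD//; last first.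
  by rewrite mulrCA mulrC ler_wpM2r// lerDr.
by rewrite ler_wpM2r ?powR_ge0// lerDl mulr_ge0// powR_ge0.
Qed.

End powers.

(** * Recursions for moments under the tilted law *)

Section moments.
Context (R : realType) d (T : measurableType d) dS (S : measurableType dS).
Variables (Z : branching_data T S) (P Pa : probability T R) (m lambda alpha : R).
Hypotheses (m_gt0 : 0 < m) (lambda_gt0 : 0 < lambda).
Hypothesis hZ : iid_environment_and_offspring Z P.
Hypothesis hPa : tilted_law Z m lambda P alpha Pa.
Local Notation L := (Lambda Z m lambda P alpha).
Local Notation cZ := (canonical_data Z).
Local Notation paths := (process nat S * process (nat * nat)%type nat)%type.
Local Open Scope ereal_scope.

(** Restart and untilting in one step: the future stays under [Pa], while the first generation moves
    to [P] and releases e^(-L). *)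
Lemma integral_restart_tilted (F : paths -> nat -> \bar R) x :
  (forall k, measurable_fun [set: paths] (F ^~ k)) -> (forall w k, 0 <= F w k) ->
  \int[Pa]_w ((M Z m lambda 0 w `^ (- alpha))%R%:E *
    F (shift_paths (history Z w)) (Psi Z 0 x w)) =
  (expR (- L))%:E * transition Z P (fun k => \int[Pa]_w F (history Z w) k) x.
Proof.
move=> mF F0.
have := integral_restart (tilted_iid m_gt0 lambda_gt0 hZ hPa) x
  (g := fun s => ((m * lambda * (mark_A Z s)%:R) `^ (- alpha))%R%:E) _ _ mF F0.
move=> ->; last 2 first.
- apply/measurable_EFinP.
  exact: (measurable_fun_mark_A Z (fun k => (m * lambda * k%:R) `^ (- alpha))%R).
- by move=> s; rewrite lee_fin powR_ge0.
pose phi (h : S * process nat nat) : \bar R :=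
  \int[Pa]_w F (history Z w) (progeny Z h x).
apply: (integral_tilted_first m_gt0 lambda_gt0 hZ hPa (phi := phi)).
  exact: (measurableT_comp (measurable_fun_nat
    (fun k => \int[Pa]_w F (history Z w) k)) (measurable_progeny Z x)).
by move=> h; exact: integral_ge0.
Qed.

(** Stated for any functional that is divided by M_0 when restarted; W_n, the size of its increments
    and V are the three instances. [G] is the version of [f] on path space, where the shift acts. *)
Lemma moment_restart (f : nat -> T -> R) (G : nat -> paths -> R) x :
  (forall k, measurable_fun [set: paths] (G k)) ->
  (forall k w, (0 <= G k w)%R) ->
  (forall k w, f k w = G k (history Z w)) ->
  \int[Pa]_w (((M Z m lambda 0 w)^-1 * G (Psi Z 0 x w)
     (shift_paths (history Z w))) `^ alpha)%R%:E =
  (expR (- L))%:E * transition Z P (fun k => \int[Pa]_w (f k w `^ alpha)%R%:E) x.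
Proof.
move=> mG G0 fG.
under eq_integral => w _.
  rewrite powRM//; last by rewrite invr_ge0 ltW// M_gt0.
  rewrite powR_inv ?EFinM; last by rewrite ltW// M_gt0.
  over.
rewrite (integral_restart_tilted x (F := fun w k => (G k w `^ alpha)%R%:E)).
- congr (_ * transition _ _ _ _); apply/funext => k; apply: eq_integral => w _.
  by rewrite fG.
- move=> k; apply/measurable_EFinP.
  exact: (measurableT_comp (measurable_powR _) (mG k)).
- by move=> w k; rewrite lee_fin powR_ge0.
Qed.

Lemma integral_X_restart (phi : nat -> \bar R) x n : (forall k, 0 <= phi k) ->
  \int[P]_w phi (X Z x n.+1 w) =
  transition Z P (fun k => \int[P]_w phi (X Z k n w)) x.
Proof.
move=> phi0.
have := integral_restart hZ x (g := fun=> 1)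
  (F := fun w k => phi (X cZ k n w)) (measurable_cst _) (fun=> lee01)
  (fun k => measurable_fun_X cZ k n phi) (fun _ _ => phi0 _).
under eq_integral do rewrite mul1e.
under [X in _ = X -> _]eq_integral do rewrite mul1e.
move=> h; rewrite /transition.
transitivity (\int[P]_w phi (X cZ (Psi Z 0 x w) n (shift_paths (history Z w)))).
  apply: eq_integral => w _; congr phi.
  by rewrite -X_history X_shift.
rewrite h; apply: eq_integral => w _; apply: eq_integral => w' _.
by rewrite X_history.
Qed.

(** Iterating P gives the law of X_n under [P], so a moment at time n under [Pa] becomes a
    discounted expectation under [P] of its time-zero value. *)
Lemma transition_iterate (a : nat -> nat -> \bar R) n x :
  (forall n x, 0 <= a n x) ->
  (forall n x, a n.+1 x = (expR (- L))%:E * transition Z P (a n) x) ->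
  a n x = (expR (- n%:R * L))%:E * \int[P]_w a 0%N (X Z x n w).
Proof.
move=> a0 aS; elim: n x => [|n IH] x.
  rewrite oppr0 mul0r expR0 mul1e /= integral_cst//.
  by rewrite [X in _ * X](_ : _ = 1) ?mule1//; exact: probability_setT.
rewrite aS integral_X_restart// /transition.
under eq_integral do rewrite IH.
rewrite ge0_integralZl//.
- rewrite muleA -EFinM -expRD; congr ((expR _)%:E * _).
  by rewrite -addn1 natrD; ring.
- exact: (measurableT_comp (measurable_fun_nat
    (fun k => \int[P]_w a 0%N (X Z k n w))) (measurable_Psi Z 0 x)).
- by move=> w _; exact: integral_ge0.
Qed.

Definition W_moment (n x : nat) : \bar R :=
  \int[Pa]_w (W Z m lambda x n w `^ alpha)%R%:E.

Definition W_increment (x n : nat) (w : T) : R :=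
  (`|W Z m lambda x n.+1 w - W Z m lambda x n w|)%R.

Definition increment_moment (n x : nat) : \bar R :=
  \int[Pa]_w (W_increment x n w `^ alpha)%R%:E.

Lemma W_moment_ge0 n x : 0 <= W_moment n x.
Proof. by apply: integral_ge0 => w _; rewrite lee_fin powR_ge0. Qed.

Lemma increment_moment_ge0 n x : 0 <= increment_moment n x.
Proof. by apply: integral_ge0 => w _; rewrite lee_fin powR_ge0. Qed.

Lemma W_momentS n x :
  W_moment n.+1 x = (expR (- L))%:E * transition Z P (W_moment n) x.
Proof.
rewrite -(moment_restart x (f := fun k => W Z m lambda k n)
  (G := fun k => W cZ m lambda k n)).
- apply: eq_integral => w _; congr (_ `^ _)%R%:E.
  by rewrite -W_history W_shift.
- by move=> k; exact: measurable_W.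
- by move=> k w; exact: W_ge0.
- by move=> k w; rewrite W_history.
Qed.

Lemma increment_momentS n x :
  increment_moment n.+1 x = (expR (- L))%:E * transition Z P (increment_moment n) x.
Proof.
rewrite -(moment_restart x (f := fun k => W_increment k n)
  (G := fun k w => `|W cZ m lambda k n.+1 w - W cZ m lambda k n w|%R)).
- apply: eq_integral => w _; congr (_ `^ _)%R%:E.
  rewrite /W_increment -!(W_history Z) [X in (`|X - _|)%R]W_shift.
  rewrite [X in (`|_ - X|)%R]W_shift -mulrBr normrM ger0_norm//.
  by rewrite invr_ge0 ltW// (M_gt0 Z m_gt0 lambda_gt0 0 w).
- move=> k; apply: measurableT_comp => //.
  by apply: measurable_funB; exact: measurable_W.
- by move=> k w; exact: normr_ge0.
- by move=> k w; rewrite /W_increment -!(W_history Z).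
Qed.

Lemma moment_const_harmonic x : moment_const Z m lambda Pa alpha x =
  (expR (- L))%:E * transition Z P (moment_const Z m lambda Pa alpha) x.
Proof.
rewrite [X in transition _ _ X](_ : _ =
  fun k => \int[Pa]_w (V Z m lambda k w `^ alpha)%R%:E); last first.
  by apply/funext => k; rewrite /moment_const unlock.
rewrite -(moment_restart x (f := fun k => V Z m lambda k)
  (G := fun k => V cZ m lambda k)).
- rewrite /moment_const unlock; apply: eq_integral => w _; congr (_ `^ _)%R%:E.
  exact: V_restart.
- by move=> k; exact: measurable_V.
- by move=> k w; exact: V_ge0.
- by move=> k w; rewrite V_history.
Qed.

Lemma W0 x w : (W Z m lambda x 0 w = x%:R)%R.
Proof. by rewrite /W /Delta big_ord0 /= divr1. Qed.

(** The first increment is D(x)/M_0, and its weight M_0^(-alpha) is exactly what the untilting of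
    generation 0 absorbs. *)
Lemma increment_moment0 x : increment_moment 0 x =
  (expR (- L))%:E * 'E_P[fun w => (`|D Z m lambda x w| `^ alpha)%R].
Proof.
rewrite unlock.
pose phi (h : S * process nat nat) : \bar R :=
  (`|(progeny Z h x)%:R - m * lambda * (mark_A Z h.1)%:R * x%:R| `^ alpha)%R%:E.
have mphi : measurable_fun setT phi.
  apply/measurable_EFinP; apply: (measurableT_comp (measurable_powR _)).
  apply: measurableT_comp => //; apply: measurable_funB.
    exact: (measurableT_comp (measurable_fun_nat (fun k : nat => k%:R : R))
      (measurable_progeny Z x)).
  exact: (measurableT_comp (measurable_fun_mark_A Z
    (fun k => m * lambda * k%:R * x%:R)%R) measurable_fst).
have phi0 h : 0 <= phi h by rewrite lee_fin powR_ge0.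
rewrite -(integral_tilted_first m_gt0 lambda_gt0 hZ hPa mphi phi0).
apply: eq_integral => w _; rewrite /phi -EFinM; congr (_%:E).
have M0 := M_gt0 Z m_gt0 lambda_gt0 0 w.
rewrite -powR_inv ?(ltW M0)// -powRM ?invr_ge0 ?(ltW M0)//.
congr (_ `^ _)%R; rewrite /W_increment W0 /W /Delta big_ord1 /=.
rewrite -[X in (X * `|_|)%R](gtr0_norm (x := (M Z m lambda 0 w)^-1)) ?invr_gt0//.
rewrite -normrM mulrBr -!/(M Z m lambda 0 w) mulKf ?gt_eqF//.
by rewrite mulrC.
Qed.

End moments.

(** * Strict positivity of the exponent Lambda(alpha) *)

Section Lambda_positive.
Context (R : realType) d (T : measurableType d) dS (S : measurableType dS).
Variables (Z : branching_data T S) (P : probability T R).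
Variables (m lambda alpha mu : R).
Hypotheses (m_gt0 : 0 < m) (lambda_gt0 : 0 < lambda) (alpha_gt0 : 0 < alpha).
Hypothesis hnonarith : non_arithmetic P (fun w => ln (M Z m lambda 0 w)).
Hypothesis hlogM : P.-integrable [set: T] (fun w => (ln (M Z m lambda 0 w))%:E).
Hypothesis hmu : 'E_P[fun w => ln (M Z m lambda 0 w)]%E = mu%:E.
Hypothesis mu_ge0 : 0 <= mu.
Hypothesis halpha : D_Lambda Z m lambda P alpha.

(* Strict form of [e^y >= 1 + y], with y = alpha log M of nonnegative mean;
   [y = 0] almost surely would make log M arithmetic. *)
Lemma Lambda_gt0 : 0 < Lambda Z m lambda P alpha.
Proof.
pose y w := alpha * ln (M Z m lambda 0 w).
have ME w : M Z m lambda 0 w `^ alpha = expR (y w).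
  by rewrite /powR gt_eqF// M_gt0.
pose E := 'E_P[fun w => (M Z m lambda 0 w `^ alpha)%R]%E.
have E0 : (0 <= E)%E by apply: expectation_ge0 => w; exact: powR_ge0.
have Eoo : (E < +oo)%E.
  rewrite ltey; apply/eqP => Ey.
  by move: halpha; rewrite /D_Lambda /Lambda_ext /= -/E Ey ltxx.
have EE : E = (fine E)%:E by rewrite fineK// ge0_fin_numE.
have EI : E = (\int[P]_w (expR (y w))%:E)%E.
  by rewrite /E unlock; apply: eq_integral => w _; rewrite ME.
have iM : P.-integrable setT (fun w => (expR (y w))%:E).
  apply/integrableP; split.
    apply/measurable_EFinP.
    exact: (measurable_fun_M Z m lambda 0 (fun r => expR (alpha * ln r))).
  under eq_integral do rewrite gee0_abs ?lee_fin ?expR_ge0//.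
  by rewrite -EI.
have iy : P.-integrable setT (fun w => (y w)%:E).
  by rewrite /y; under eq_fun do rewrite EFinM; exact: integrableZl.
have i1 : P.-integrable setT (cst 1%:E : T -> \bar R).
  exact: finite_measure_integrable_cst.
have i1y : P.-integrable setT (fun w => (1 + y w)%:E).
  by under eq_fun do rewrite EFinD; exact: integrableD.
have int1y : (\int[P]_w (1 + y w)%:E)%E = (1 + alpha * mu)%:E.
  under eq_integral do rewrite EFinD.
  rewrite integralD//= integral_cst// mul1e [X in (X + _)%E](_ : _ = 1%E); last first.
    exact: probability_setT.
  rewrite /y; under eq_integral do rewrite EFinM.
  rewrite integralZl// EFinD EFinM; congr (_ + _ * _)%E.
  by rewrite -hmu unlock.
have E1 : 1 < fine E.
  rewrite ltNge; apply/negP => E1.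
  (* If E M^alpha <= 1, this nonnegative function has integral at most -alpha mu <= 0, so it
     vanishes almost everywhere. *)
  have h0 w : 0 <= expR (y w) - (1 + y w) by rewrite subr_ge0 expR_ge1Dx.
  have ih : P.-integrable setT (fun w => (expR (y w) - (1 + y w))%:E).
    by under eq_fun do rewrite EFinB; exact: integrableB.
  have : (\int[P]_w `|(expR (y w) - (1 + y w))%:E| = 0)%E.
    under eq_integral do rewrite gee0_abs ?lee_fin//.
    apply/eqP; rewrite eq_le integral_ge0 ?andbT//; last by move=> w _; rewrite lee_fin.
    under eq_integral do rewrite EFinB.
    rewrite integralB// int1y.
    rewrite -EI EE -EFinB lee_fin subr_le0 (le_trans E1)// lerDl.
    by rewrite mulr_ge0// ltW.
  move/(ae_eq_integral_abs _ measurableT (measurable_int _ ih)) => ae0.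
  (* The lattice is that of span 1. Writing membership as a boolean function of M makes the event
     measurable, since M takes countably many values. *)
  pose f (r : R) := `[< exists z : int, ln r = 1 * z%:~R :> R >].
  pose A := (fun w => ln (M Z m lambda 0 w)) @^-1`
    [set r : R | exists z : int, r = 1 * z%:~R].
  have AE : A = (fun w => f (M Z m lambda 0 w)) @^-1` [set true].
    by apply/seteqP; split => w /= /asboolP.
  have mA : measurable A.
    by rewrite AE; apply: preimage_measurable => //; exact: measurable_fun_M.
  have PA : P (~` A) = 0%E.
    apply: measure_negligible; first exact: measurableC.
    apply: negligibleS ae0 => w /= nA h; apply: nA.
    have [y0|yn0] := eqVneq (y w) 0.
      exists 0; rewrite mulr0; apply/eqP.
      by move/eqP: y0; rewrite mulf_eq0 gt_eqF.
    have := h I => /= -[] /eqP; rewrite subr_eq0 => /eqP h1.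
    by have := expR_gt1Dx yn0; rewrite h1 ltxx.
  have /negP := hnonarith ltr01; apply; apply/eqP.
  have := probability_setC P mA; rewrite PA => /esym/eqP.
  by rewrite sube_eq ?fin_num_measure// ?add0e => /eqP <-.
rewrite /Lambda /Lambda_ext -/E EE /lne leNgt (lt_trans ltr01 E1)/=.
by rewrite ln_gt0.
Qed.

End Lambda_positive.

(** * Geometric decay of the increments *)

Section moment_bounds.
Context (R : realType) d (T : measurableType d) dS (S : measurableType dS).
Variables (Z : branching_data T S) (P Pa : probability T R).
Variables (m lambda alpha beta C : R).
Hypotheses (m_gt0 : 0 < m) (lambda_gt0 : 0 < lambda).
Hypothesis hZ : iid_environment_and_offspring Z P.
Hypothesis hPa : tilted_law Z m lambda P alpha Pa.
Hypotheses (alpha_gt0 : 0 < alpha) (beta_ge0 : 0 <= beta) (beta_lt : beta < alpha).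
Hypothesis hD : forall k : nat,
  ('E_P[fun w => (`|D Z m lambda k w| `^ alpha)%R] <=
    (C * (1 + k%:R `^ beta))%R%:E)%E.
Local Notation L := (Lambda Z m lambda P alpha).
Hypothesis L_gt0 : 0 < L.
Local Notation r := (expR (- ((1 - beta / alpha) * L))).
Local Notation Wmom := (W_moment Z Pa m lambda alpha).
Local Notation Imom := (increment_moment Z Pa m lambda alpha).
Local Open Scope ereal_scope.

Lemma W_moment0 x : Wmom 0 x = (x%:R `^ alpha)%:E.
Proof.
rewrite /W_moment; under eq_integral do rewrite W0.
rewrite integral_cst//= [X in _ * X](_ : _ = 1) ?mule1//.
exact: probability_setT.
Qed.

(** The increment is e^(-nL) times the mean under [P] of its time-zero moment at X_n. Interpolating
    X_n^beta at scale t = e^(nL/alpha) gives e^(-nL) t^beta = r^n, and e^(-nL) E X_n^alpha is the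
    moment of W_n. The factor 2 absorbs the additive 1, as t^beta >= 1. *)
Lemma increment_moment_le n x :
  Imom n x <= (2 * `|C| * r ^+ n)%:E * (1 + Wmom n x).
Proof.
pose t := expR (n%:R * L / alpha).
have nL : (0 <= n%:R * L)%R by rewrite mulr_ge0// ltW.
have t0 : (0 < t)%R by exact: expR_gt0.
have tb : (t `^ beta = expR (n%:R * L * (beta / alpha)))%R.
  by rewrite /t -expRM; congr expR; field; rewrite gt_eqF.
have tb1 : (1 <= t `^ beta)%R.
  rewrite tb -[leLHS]expR0 ler_expR; apply: mulr_ge0 => //.
  by apply: divr_ge0 => //; exact: ltW.
have pointwise (k : nat) : Imom 0 k <=
    (2 * `|C| * t `^ beta * (1 + expR (- n%:R * L) * k%:R `^ alpha))%:E.
  rewrite (increment_moment0 m_gt0 lambda_gt0 hZ hPa).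
  (* The factor e^(-L) <= 1 of the time-zero increment is dropped, and [C] is replaced by its
     absolute value to have a nonnegative constant. *)
  apply: (@le_trans _ _ (`|C| * (1 + k%:R `^ beta))%:E).
    apply: (@le_trans _ _ (1 * (C * (1 + k%:R `^ beta))%:E)).
      apply: lee_pmul => //.
      - by apply: expectation_ge0 => w; exact: powR_ge0.
      - by rewrite lee_fin -expR0 ler_expR oppr_le0 ltW.
    rewrite mul1e lee_fin ler_wpM2r ?ler_norm//.
  rewrite lee_fin -!mulrA mulrCA ler_wpM2l ?normr_ge0//.
  have := powR_le_interpolate beta_ge0 beta_lt t0 (ler0n R k).
  have -> : ((k%:R / t) `^ alpha = expR (- n%:R * L) * k%:R `^ alpha)%R.
    rewrite powRM ?invr_ge0 ?(ltW t0)// mulrC powR_inv ?(ltW t0)//.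
    by rewrite /t -expRM; congr (expR _ * _)%R; field; rewrite gt_eqF.
  set y := (expR _ * _)%R => h.
  have y0 : (0 <= y)%R by rewrite mulr_ge0 ?expR_ge0 ?powR_ge0.
  have := mulr_ge0 (ltW (lt_le_trans ltr01 tb1)) y0.
  lra.
rewrite (transition_iterate (m := m) (lambda := lambda) (alpha := alpha)
  (a := Imom) hZ); last 2 first.
- by move=> *; exact: increment_moment_ge0.
- by move=> *; exact: increment_momentS.
have WE : Wmom n x =
    (expR (- n%:R * L))%:E * \int[P]_w ((X Z x n w)%:R `^ alpha)%:E.
  rewrite (transition_iterate (m := m) (lambda := lambda) (alpha := alpha)
    (a := Wmom) hZ).
  - by congr (_ * _); apply: eq_integral => w _; rewrite W_moment0.
  - by move=> *; exact: W_moment_ge0.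
  - by move=> *; exact: W_momentS.
have mXa : measurable_fun setT (fun w => ((X Z x n w)%:R `^ alpha)%:E : \bar R).
  exact: (measurable_fun_X Z x n (fun k => (k%:R `^ alpha)%:E : \bar R)).
have Xa0 w : 0 <= ((X Z x n w)%:R `^ alpha)%:E :> \bar R.
  by rewrite lee_fin powR_ge0.
have -> : (2 * `|C| * r ^+ n)%:E * (1 + Wmom n x) =
    (expR (- n%:R * L))%:E *
    \int[P]_w (2 * `|C| * t `^ beta *
      (1 + expR (- n%:R * L) * (X Z x n w)%:R `^ alpha))%:E.
  under eq_integral do rewrite EFinM EFinD [X in _ * (_ + X)]EFinM.
  rewrite ge0_integralZl//; last 3 first.
  - by apply: emeasurable_funD => //; exact: emeasurable_funM.
  - by move=> w _; rewrite adde_ge0// mule_ge0// lee_fin expR_ge0.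
  - by rewrite lee_fin !mulr_ge0// powR_ge0.
  rewrite ge0_integralD//; last exact: emeasurable_funM.
  rewrite ge0_integralZl//.
  rewrite -WE integral_cst// mul1e [X in _ * (_ * (X + _))](_ : _ = 1); last first.
    exact: probability_setT.
  rewrite muleA -EFinM tb; congr (_%:E * _).
  rewrite -expRM_natl mulrCA -expRD; congr (_ * expR _)%R.
  by field; rewrite gt_eqF.
apply: lee_wpmul2l; first by rewrite lee_fin expR_ge0.
apply: ge0_le_integral => //.
- by move=> w _; exact: increment_moment_ge0.
- exact: (measurable_fun_X Z x n (Imom 0)).
- exact: (measurable_fun_X Z x n (fun k => (2 * `|C| * t `^ beta *
    (1 + expR (- n%:R * L) * k%:R `^ alpha))%:E : \bar R)).
Qed.

Lemma measurable_W_increment x n :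
  measurable_fun setT (W_increment Z m lambda x n).
Proof.
apply: measurableT_comp => //.
by apply: measurable_funB; exact: measurable_W.
Qed.

Lemma W_moment_add (b K : R) n x : (0 <= b)%R -> (0 <= K)%R ->
  (forall a c : R, 0 <= a -> 0 <= c ->
    (a + c) `^ alpha <= b * a `^ alpha + K * c `^ alpha)%R ->
  Wmom n.+1 x <= b%:E * Wmom n x + K%:E * Imom n x.
Proof.
move=> b0 K0 bK.
have mW k : measurable_fun setT (fun w => (W Z m lambda x k w `^ alpha)%:E).
  apply/measurable_EFinP.
  exact: (measurableT_comp (measurable_powR _) (measurable_W _ _ _ _ _)).
have mI : measurable_fun setT (fun w => (W_increment Z m lambda x n w `^ alpha)%:E).
  apply/measurable_EFinP.
  exact: (measurableT_comp (measurable_powR _) (measurable_W_increment _ _)).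
have p0 (a : R) : 0 <= (a `^ alpha)%:E by rewrite lee_fin powR_ge0.
rewrite /W_moment /increment_moment -!ge0_integralZl// -ge0_integralD//.
- apply: ge0_le_integral => //.
  + by apply: emeasurable_funD; exact: emeasurable_funM.
  + move=> w _; rewrite -!EFinM -EFinD lee_fin.
    apply: (le_trans _ (bK _ _ (W_ge0 Z m_gt0 lambda_gt0 x n w) (normr_ge0 _))).
    apply: ge0_ler_powR; rewrite ?nnegrE ?(ltW alpha_gt0)// ?W_ge0//.
      by rewrite addr_ge0// W_ge0.
    by rewrite -lerBlDl ler_norm.
- by move=> w _; rewrite mule_ge0.
- exact: emeasurable_funM.
- by move=> w _; rewrite mule_ge0.
- exact: emeasurable_funM.
Qed.

(** Feeding the increment bound into [W_moment_add] yields 1 + E W_(n+1)^alpha <= b (1 + K' r^n)(1 +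
    E W_n^alpha). The product of the brackets converges, so the moments grow at most like b^n and
    the increments decay like (r b)^n. *)
Lemma increment_moment_geometric : exists q K : R,
  [/\ (0 < q)%R, (q < 1)%R, (0 <= K)%R & forall n x,
    Imom n x <= (K * q ^+ n * (1 + x%:R `^ alpha))%:E].
Proof.
have r0 : (0 < r)%R by exact: expR_gt0.
have r1 : (r < 1)%R.
  rewrite -[ltRHS]expR0 ltr_expR oppr_lt0 mulr_gt0// subr_gt0.
  by rewrite ltr_pdivrMr// mul1r.
pose C0 := (2 * `|C|)%R; have C00 : (0 <= C0)%R by rewrite mulr_ge0.
have incr n x : Imom n x <= (C0 * r ^+ n)%:E * (1 + Wmom n x).
  exact: increment_moment_le.
clearbody C0.
(* The midpoint of 1 and 1/r: larger than 1, yet r b = (r + 1)/2 is below 1. *)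
pose b := ((1 + r^-1) / 2)%R.
have ri : (1 < r^-1)%R by rewrite invf_gt1.
have b1 : (1 < b)%R by rewrite /b; lra.
have b0 : (0 <= b)%R by rewrite ltW// (lt_trans ltr01).
have rb : (r * b = (r + 1) / 2)%R by rewrite /b; field; rewrite gt_eqF.
clearbody b.
have [K K0 bK] := powR_add_le alpha_gt0 b1.
pose K' := (K * C0)%R; have K'0 : (0 <= K')%R by rewrite mulr_ge0.
have K'E : K' = (K * C0)%R by [].
clearbody K'.
(* The exponent is K' times the sum of r^i over i < n, from bounding each factor 1 + K' r^i by its
   exponential. *)
pose B n := (b ^+ n * expR (K' * (1 - r ^+ n) / (1 - r)))%R.
have B0 n : (0 <= B n)%R by rewrite mulr_ge0 ?exprn_ge0 ?expR_ge0.
have WB n x : 1 + Wmom n x <= (B n * (1 + x%:R `^ alpha))%:E.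
  elim: n => [|n IH].
    by rewrite W_moment0 /B !expr0 subrr mulr0 mul0r expR0 !mul1r.
  have W0 := W_moment_ge0 Z Pa m lambda alpha n x.
  (* Finiteness comes from the induction hypothesis and allows the step to be computed in [R]. *)
  have Wfin : Wmom n x \is a fin_num.
    rewrite ge0_fin_numE//; apply: (le_lt_trans _ (ltry _)); apply: (le_trans _ IH).
    exact: leeDr.
  have [w wE] : exists w, Wmom n x = w%:E by exists (fine (Wmom n x)); rewrite fineK.
  have step : 1 + Wmom n.+1 x <= (1 + (b * w + K * (C0 * r ^+ n * (1 + w))))%:E.
    rewrite EFinD leeD2l//; apply: (le_trans (W_moment_add n x b0 K0 bK)).
    rewrite wE EFinD EFinM leeD2l// EFinM lee_wpmul2l//.
    by apply: (le_trans (incr n x)); rewrite wE -EFinD -EFinM.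
  apply: (le_trans step); rewrite lee_fin.
  move: IH W0; rewrite wE -EFinD !lee_fin => IH w0.
  have w1 : (0 <= 1 + w)%R by rewrite addr_ge0.
  apply: (@le_trans _ _ (b * (1 + K' * r ^+ n) * (1 + w))%R).
    have rn : (0 <= K' * r ^+ n * (1 + w))%R by rewrite !mulr_ge0// exprn_ge0// ltW.
    have : (0 <= (b - 1) * (K' * r ^+ n * (1 + w)))%R by rewrite mulr_ge0// subr_ge0 ltW.
    rewrite K'E in rn *; move: b1 rn; set y := (r ^+ n)%R; nra.
  apply: (@le_trans _ _ (b * (1 + K' * r ^+ n) * (B n * (1 + x%:R `^ alpha)))%R).
    by rewrite ler_wpM2l// mulr_ge0// addr_ge0// mulr_ge0// exprn_ge0// ltW.
  rewrite mulrA ler_wpM2r ?addr_ge0 ?powR_ge0//.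
  rewrite /B exprS -!mulrA ler_wpM2l// mulrCA ler_wpM2l ?exprn_ge0//.
  have -> : (K' * ((1 - r ^+ n.+1) * (1 - r)^-1) =
      K' * r ^+ n + K' * ((1 - r ^+ n) * (1 - r)^-1))%R.
    by rewrite exprS; field; rewrite gt_eqF// subr_gt0.
  by rewrite expRD ler_wpM2r ?expR_ge0// expR_ge1Dx.
exists (r * b)%R, (C0 * expR (K' / (1 - r)))%R.
split; [by rewrite rb; lra|by rewrite rb; lra|by rewrite mulr_ge0 ?expR_ge0|].
move=> n x; apply: (le_trans (incr n x)).
apply: (@le_trans _ _ ((C0 * r ^+ n)%:E * (B n * (1 + x%:R `^ alpha))%:E)).
  by apply: lee_wpmul2l => //; rewrite lee_fin mulr_ge0// exprn_ge0// ltW.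
rewrite -EFinM lee_fin mulrA ler_wpM2r ?addr_ge0 ?powR_ge0//.
rewrite exprMn /B -!mulrA ler_wpM2l// [leRHS]mulrCA ler_wpM2l ?exprn_ge0 ?(ltW r0)//.
rewrite [leRHS]mulrC ler_wpM2l ?exprn_ge0// ler_expR.
rewrite ler_wpM2l// ler_piMl ?invr_ge0 ?subr_ge0 ?(ltW r1)//.
Qed.

End moment_bounds.

Section powR_limits.
Context (R : realType).

(** A positive limit is handled by exp and ln; at limit 0, where ln is of no use, the smallness is
    checked directly with e^(1/alpha). *)
Lemma cvg_powR (alpha : R) (u : R^nat) (l : R) : 0 < alpha ->
  (forall n, 0 <= u n) -> u @ \oo --> l ->
  (fun n => u n `^ alpha) @ \oo --> l `^ alpha.
Proof.
move=> al0 u0 ul.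
have : 0 <= l.
  by rewrite -(cvg_lim _ ul)//; apply: limr_ge; [apply/cvg_ex; exists l|exact: nearW].
rewrite le_eqVlt => /predU1P[l0|l0].
  rewrite -l0 in ul *; rewrite powR0 ?gt_eqF//.
  apply/cvgrPdist_lt => e e0.
  have d0 : 0 < e `^ alpha^-1 by exact: powR_gt0.
  move/cvgrPdist_lt : ul => /(_ _ d0); apply: filterS => n.
  rewrite !sub0r !normrN !ger0_norm ?powR_ge0// => un.
  have -> : e = (e `^ alpha^-1) `^ alpha.
    by rewrite -powRrM mulVf ?gt_eqF// powRr1// ltW.
  by apply: gt0_ltr_powR; rewrite ?nnegrE// ltW.
have -> : l `^ alpha = expR (alpha * ln l) by rewrite /powR gt_eqF.
apply: (@cvg_trans _ ((fun n => expR (alpha * ln (u n))) @ \oo)).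
  apply: near_eq_cvg; near=> n; rewrite /powR gt_eqF//.
  near: n; exact: (cvgr_gt _ ul).
have lnu : (fun n => ln (u n)) @ \oo --> ln l.
  exact: (continuous_cvg _ (continuous_ln l0) ul).
have alnu : (fun n => alpha * ln (u n)) @ \oo --> alpha * ln l.
  exact: cvgMl_tmp.
exact: (continuous_cvg _ (@continuous_expR R (alpha * ln l)) alnu).
Unshelve. all: by end_near. Qed.

End powR_limits.

(** * Almost sure convergence and convergence of moments by domination *)

Section domination.
Context (R : realType) d (T : measurableType d) dS (S : measurableType dS).
Variables (Z : branching_data T S) (Pa : probability T R).
Variables (m lambda alpha q K0 : R).
Hypotheses (m_gt0 : 0 < m) (lambda_gt0 : 0 < lambda) (alpha_gt0 : 0 < alpha).
Hypotheses (q0 : 0 < q) (q1 : q < 1) (K00 : 0 <= K0).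
Hypothesis incr : forall n x,
  (increment_moment Z Pa m lambda alpha n x <= (K0 * q ^+ n * (1 + x%:R `^ alpha))%:E)%E.
Local Open Scope ereal_scope.

(* [g] is a multiple of x^alpha + sum_n p^-n |W_(n+1) - W_n|^alpha, q < p < 1. *)
Lemma W_domination : exists2 K : R, (0 <= K)%R & forall x, exists g : T -> \bar R,
  [/\ measurable_fun setT g, (forall w, 0 <= g w),
      \int[Pa]_w g w <= (K * (1 + x%:R `^ alpha))%:E &
      forall w, g w < +oo -> cvgn (fun n => W Z m lambda x n w) /\
        forall n, (W Z m lambda x n w `^ alpha)%:E <= g w].
Proof.
pose p := ((q + 1) / 2)%R; have [qp p1] : ((q < p)%R * (p < 1)%R)%type := midf_lt q1.
have p0 : (0 < p)%R by exact: lt_trans qp.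
clearbody p.
have s0 : (0 <= q / p)%R by rewrite divr_ge0// ltW.
have s1 : (q / p < 1)%R by rewrite ltr_pdivrMr// mul1r.
have [K1 K10 K1P] := powR_increments_cvg alpha_gt0 p0 p1.
(* Strictly positive, so that finiteness of the dominating function forces finiteness of the
   weighted series. *)
pose K2 := (K1 + 1)%R; have K20 : (0 < K2)%R by rewrite ltr_wpDl.
(* The sum of the geometric series of ratio q/p bounding the expected weighted increments. *)
pose K3 := (K0 / (1 - q / p))%R.
have K30 : (0 <= K3)%R by rewrite divr_ge0// subr_ge0 ltW.
exists (K2 * (1 + K3))%R; first by rewrite mulr_ge0 ?addr_ge0// ltW.
move=> x; pose f n w := ((p ^+ n)^-1 * W_increment Z m lambda x n w `^ alpha)%:E.
have pn0 n : (0 < p ^+ n)%R by exact: exprn_gt0.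
have f0 n w : 0 <= f n w by rewrite lee_fin mulr_ge0 ?powR_ge0// invr_ge0 ltW.
have mI n : measurable_fun setT (fun w => (W_increment Z m lambda x n w `^ alpha)%:E).
  apply/measurable_EFinP.
  by apply: (measurableT_comp (measurable_powR _)); exact: measurable_W_increment.
have mf n : measurable_fun setT (f n).
  by rewrite /f; under eq_fun do rewrite EFinM; exact: emeasurable_funM.
pose z w := \sum_(0 <= n <oo) f n w.
have z0 w : 0 <= z w by exact: nneseries_ge0.
have mz : measurable_fun setT z by exact: ge0_emeasurable_sum.
have xa0 : 0 <= (x%:R `^ alpha)%:E :> \bar R by rewrite lee_fin powR_ge0.
have intz : \int[Pa]_w z w <= (K3 * (1 + x%:R `^ alpha))%:E.
  rewrite integral_nneseries//; apply: lime_le.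
    by apply: is_cvg_nneseries => n _ _; exact: integral_ge0.
  apply: nearW => n.
  apply: (@le_trans _ _ (\sum_(0 <= i < n)
      (geometric (K0 * (1 + x%:R `^ alpha)) (q / p) i)%:E)).
    apply: lee_sum => i _; rewrite /f; under eq_integral do rewrite EFinM.
    rewrite ge0_integralZl//; last 2 first.
    - by move=> w _; rewrite lee_fin powR_ge0.
    - by rewrite lee_fin invr_ge0 ltW.
    apply: (@le_trans _ _ (((p ^+ i)^-1)%:E * (K0 * q ^+ i * (1 + x%:R `^ alpha))%:E)).
      by apply: lee_wpmul2l; [rewrite lee_fin invr_ge0 ltW|exact: incr].
    rewrite -EFinM lee_fin /geometric /= expr_div_n le_eqVlt; apply/orP; left.
    by apply/eqP; ring.
  rewrite sumEFin lee_fin.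
  rewrite -[leLHS]/(series (geometric _ _) n) geometric_seriesE ?lt_eqF//=.
  rewrite /K3 [leRHS]mulrAC ler_wpM2r ?invr_ge0 ?subr_ge0 ?(ltW s1)//.
  rewrite ler_piMr ?mulr_ge0 ?addr_ge0 ?powR_ge0//.
  by rewrite lerBlDr lerDl exprn_ge0.
exists (fun w => K2%:E * ((x%:R `^ alpha)%:E + z w)); split.
- by apply: emeasurable_funM => //; exact: emeasurable_funD.
- by move=> w; rewrite mule_ge0 ?adde_ge0// lee_fin ltW.
- rewrite ge0_integralZl//; last 3 first.
  + exact: emeasurable_funD.
  + by move=> w _; rewrite adde_ge0.
  + by rewrite lee_fin ltW.
  rewrite ge0_integralD// integral_cst//.
  rewrite [X in _ * (_ * X + _)](_ : _ = 1); last exact: probability_setT.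
  rewrite mule1 -mulrA EFinM; apply: lee_wpmul2l; first by rewrite lee_fin ltW.
  rewrite mulrDl EFinD; apply: leeD => //.
  by rewrite lee_fin mul1r lerDr.
- move=> w gfin.
  have zfin : z w \is a fin_num.
    rewrite ge0_fin_numE// ltey; apply/eqP => zoo; move: gfin.
    by rewrite zoo addey// gt0_muley ?ltxx// lte_fin.
  have [y yE] : exists y, z w = y%:E by exists (fine (z w)); rewrite fineK.
  have y0 : (0 <= y)%R by have := z0 w; rewrite yE lee_fin.
  (* Each term is at most the whole nonnegative series [y], which is the hypothesis of
     [powR_increments_cvg] with z = y. *)
  have inc n : (W_increment Z m lambda x n w `^ alpha <= y * p ^+ n)%R.
    rewrite -ler_pdivrMr// mulrC -lee_fin -yE.
    apply: (@le_trans _ _ (\sum_(0 <= i < n.+1) f i w)).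
      by rewrite big_nat_recr//= leeDr// sume_ge0.
    exact: nneseries_lim_ge.
  have [cW WK] := K1P (fun n => W Z m lambda x n w) y
    (fun n => W_ge0 Z m_gt0 lambda_gt0 x n w) y0 inc.
  split => // n; rewrite yE -EFinD -EFinM lee_fin.
  apply: (le_trans (WK n)); rewrite W0 ler_wpM2r ?addr_ge0 ?powR_ge0//.
  by rewrite lerDl.
Qed.

Local Notation c := (moment_const Z m lambda Pa alpha).
Local Notation Wmom := (W_moment Z Pa m lambda alpha).

(** The dominating function is integrable, hence almost surely finite, and there are only countably
    many initial states to intersect. *)
Lemma W_converges :
  {ae Pa, forall w, forall x : nat, cvgn (fun n => W Z m lambda x n w)}.
Proof.
have [K K_ge0 dom] := W_domination; apply: ae_foralln => x.
have [g [mg g0 gK gP]] := dom x.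
have ig : Pa.-integrable setT g.
  apply/integrableP; split => //; under eq_integral do rewrite gee0_abs//.
  exact: (le_lt_trans gK (ltry _)).
have := integrable_ae measurableT ig; apply: filterS => w /(_ I) gfin.
by apply: (gP w _).1; rewrite -ge0_fin_numE.
Qed.

(** The uniform bound, affine in x^alpha, is recorded with the limit because it is what dominates
    when the initial state is random. *)
Lemma W_moment_cvg : exists2 K : R, (0 <= K)%R & forall x,
  (forall n, Wmom n x <= (K * (1 + x%:R `^ alpha))%:E) /\
  (fun n => Wmom n x) @ \oo --> c x.
Proof.
have [K K_ge0 dom] := W_domination; exists K => // x.
have [g [mg g0 gK gP]] := dom x.
have ig : Pa.-integrable setT g.
  apply/integrableP; split => //; under eq_integral do rewrite gee0_abs//.
  exact: (le_lt_trans gK (ltry _)).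
have mW n : measurable_fun setT (fun w => (W Z m lambda x n w `^ alpha)%:E).
  apply/measurable_EFinP.
  exact: (measurableT_comp (measurable_powR _) (measurable_W _ _ _ _ _)).
have mV : measurable_fun setT (fun w => (V Z m lambda x w `^ alpha)%:E).
  apply/measurable_EFinP.
  exact: (measurableT_comp (measurable_powR _) (measurable_V _ _ _ _)).
have gfin : {ae Pa, forall w, g w < +oo}.
  have := integrable_ae measurableT ig; apply: filterS => w /(_ I).
  by rewrite ge0_fin_numE.
have cv : {ae Pa, forall w, [set: T] w ->
    (W Z m lambda x n w `^ alpha)%:E @[n --> \oo] --> (V Z m lambda x w `^ alpha)%:E}.
  apply: filterS gfin => w /gP[cW _] _.
  apply: cvg_EFin; first exact: nearW.
  apply: cvg_powR => // n; exact: W_ge0.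
have le : {ae Pa, forall w, forall n, [set: T] w ->
    `|(W Z m lambda x n w `^ alpha)%:E| <= g w}.
  apply: filterS gfin => w /gP[_ Wg] n _.
  by rewrite gee0_abs ?lee_fin ?powR_ge0.
split.
  move=> n; apply: (le_trans _ gK); apply: ae_ge0_le_integral => //.
  - by move=> w _; rewrite lee_fin powR_ge0.
  - by apply: filterS gfin => w /gP[_ Wg] _.
have [_ _] := dominated_convergence measurableT mW mV cv ig le.
by rewrite /moment_const unlock.
Qed.

Lemma moment_const_le : exists2 K : R, (0 <= K)%R &
  forall x, c x <= (K * (1 + x%:R `^ alpha))%:E.
Proof.
have [K K_ge0 KP] := W_moment_cvg; exists K => // x; have [Wle Wc] := KP x.
rewrite -(cvg_lim _ Wc)//; apply: lime_le; first by apply/cvg_ex; exists (c x).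
exact: nearW.
Qed.

Lemma moment_const_ge0 x : 0 <= c x.
Proof. by apply: expectation_ge0 => w; exact: powR_ge0. Qed.

End domination.

(** * The limit *)

(** The inverse is x times the power -1 of x^2, an identity that also holds at 0. *)
Lemma measurable_inv (R : realType) : measurable_fun [set: R] (@GRing.inv R).
Proof.
have -> : @GRing.inv R = fun x => x * (x * x) `^ (-1).
  apply/funext => x; have [->|x0] := eqVneq x 0; first by rewrite invr0 mul0r.
  have xx : 0 <= x * x by rewrite -expr2 sqr_ge0.
  by rewrite powR_inv1// invfM mulrA divff// mul1r.
apply: measurable_funM => //.
by apply: (measurableT_comp (measurable_powR _)); exact: measurable_funM.
Qed.

(** * The distributional equation for the limits *)

Section distributional_equation.
Context (R : realType) d (T : measurableType d) dS (S : measurableType dS).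
Variables (Z : branching_data T S) (Q : probability T R) (m lambda : R).
Hypotheses (m_gt0 : 0 < m) (lambda_gt0 : 0 < lambda).
Hypothesis hQ : iid_environment_and_offspring Z Q.
Local Notation cZ := (canonical_data Z).

(** The restart identity writes the whole family V as [Phi] of the first-generation map and the
    limits along the shifted path. These two are independent and the second has the law of V, so any
    independent pair with the same marginals has the same image under [Phi]. *)
Lemma V_process_law d' (T' : measurableType d') (P' : probability T' R)
    (MPsi : {mfun T' >-> (R * process nat nat)%type})
    (V' : {mfun T' >-> process nat R}) :
  same_law P' MPsi Q (M_Psi Z m lambda) ->
  same_law P' V' Q (V_process Z m lambda) ->
  independent P' MPsi V' ->
  same_law Q (V_process Z m lambda)
    P' ((fun w x => (MPsi w).1^-1 * V' w ((MPsi w).2 x)) : T' -> process nat R).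
Proof.
move=> lMPsi lV' ind.
pose Phi (z : (R * process nat nat) * process nat R) : process nat R :=
  fun x => z.1.1^-1 * z.2 (z.1.2 x).
have mPhi : measurable_fun setT Phi.
  apply: measurable_fun_process => x; apply: measurable_funM.
    apply: (measurableT_comp (@measurable_inv R)).
    exact: (measurableT_comp measurable_fst measurable_fst).
  apply: (measurable_fun_nat_bind
    (N := fun z : (R * process nat nat) * process nat R => z.1.2 x)
    (F := fun k (z : (R * process nat nat) * process nat R) => z.2 k)).
    exact: (measurableT_comp (@measurable_fun_coordinate nat _ nat x)
      (measurableT_comp measurable_snd measurable_fst)).
  move=> k; exact: (measurableT_comp (@measurable_fun_coordinate nat _ R k)
    measurable_snd).
pose Vs w := V_process cZ m lambda (shift_paths (history Z w)).
have mVs : measurable_fun setT Vs.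
  exact: (measurableT_comp (measurable_V_process cZ m lambda)
    (measurableT_comp (@measurable_shift_paths _ S) (measurable_history Z))).
have VE : V_process Z m lambda = fun w => Phi (M_Psi Z m lambda w, Vs w).
  apply/funext => w; apply/funext => x.
  exact: (V_restart Z m_gt0 lambda_gt0 x w).
have VH w : V_process cZ m lambda (history Z w) = V_process Z m lambda w.
  by apply/funext => x; exact: V_history.
have lVs : same_law P' V' Q Vs.
  move=> A mA; rewrite lV'//.
  have <- : (fun w => V_process cZ m lambda (history Z w)) = V_process Z m lambda.
    by apply/funext => w; exact: VH.
  apply/esym.
  exact: (same_law_comp (measurable_V_process cZ m lambda) (same_law_shift hQ) mA).
have iVs : independent Q (M_Psi Z m lambda) Vs.
  pose f (h : S * process nat nat) : R * process nat nat :=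
    (m * lambda * (mark_A Z h.1)%:R, fun k => progeny Z h k).
  have mf : measurable_fun setT f.
    apply: measurable_fun_pair.
      exact: (measurableT_comp
        (measurable_fun_mark_A Z (fun k => m * lambda * k%:R)) measurable_fst).
    by apply: measurable_fun_process => k; exact: measurable_progeny.
  move=> A B mA mB.
  apply: (independent_head_shift hQ (A := f @^-1` A)
    (B := V_process cZ m lambda @^-1` B)).
    exact: preimage_measurable.
  exact: (preimage_measurable (measurable_V_process cZ m lambda)).
rewrite VE.
apply: (same_law_comp (X := fun w => (M_Psi Z m lambda w, Vs w))
  (Y := fun w => (MPsi w, V' w)) mPhi); apply: same_law_sym.
apply: (same_law_pair (X := MPsi) (Y := V')) => //.
exact: measurable_M_Psi.
Qed.

End distributional_equation.

(** * Harmonicity, positivity and random initial states *)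

Section harmonic.
Context (R : realType) d (T : measurableType d) dS (S : measurableType dS).
Variables (Z : branching_data T S) (P Pa : probability T R) (m lambda alpha : R).
Hypotheses (m_gt0 : 0 < m) (lambda_gt0 : 0 < lambda).
Hypothesis hZ : iid_environment_and_offspring Z P.
Hypothesis hPa : tilted_law Z m lambda P alpha Pa.
Local Notation L := (Lambda Z m lambda P alpha).
Local Notation c := (moment_const Z m lambda Pa alpha).
Local Notation Wmom := (W_moment Z Pa m lambda alpha).
Local Open Scope ereal_scope.

Lemma transition_moment_const x : transition Z P c x = (expR L)%:E * c x.
Proof.
rewrite [c x in RHS](moment_const_harmonic m_gt0 lambda_gt0 hZ hPa).
by rewrite muleA -EFinM expRxMexpNx_1 mul1e.
Qed.

(** By harmonicity the constant sequence [c] satisfies the recursion, so c(x) = e^(-nL) E c(X_n),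
    which is at least the contribution of the event X_n = y. *)
Lemma moment_const_gt0 x n y :
  0 < P [set w | X Z x n w = y] -> 0 < c y -> 0 < c x.
Proof.
move=> Py cy; have c0 := moment_const_ge0 Z Pa m lambda alpha.
rewrite (transition_iterate (m := m) (lambda := lambda) (alpha := alpha)
  (a := fun=> c) hZ n x (fun=> c0)); last first.
  by move=> _ k; exact: moment_const_harmonic.
rewrite mule_gt0 ?lte_fin ?expR_gt0// integral_nat_valued//; last exact: measurable_X.
apply: (@lt_le_trans _ _ (P [set w | X Z x n w = y] * c y)).
  exact: mule_gt0.
apply: (@le_trans _ _ (\sum_(0 <= k < y.+1) P (X Z x n @^-1` [set k]) * c k)).
  by rewrite big_nat_recr//= leeDr// sume_ge0// => i _; exact: mule_ge0.
by apply: nneseries_lim_ge => k _ _; exact: mule_ge0.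
Qed.

(** Given the initial state the discounted moment is the moment of W_n under [Pa]; dominated
    convergence over the initial law then exchanges limit and sum. *)
Lemma initial_law_limit (nu : probability nat R) (X0 : {mfun T >-> nat}) (K : R) :
  (0 < alpha)%R -> (0 <= K)%R ->
  (forall x, (forall n, Wmom n x <= (K * (1 + x%:R `^ alpha))%:E) /\
     (fun n => Wmom n x) @ \oo --> c x) ->
  (forall A, P (X0 @^-1` A) = nu A) ->
  independent P X0 (history Z) ->
  \sum_(0 <= x <oo) nu [set x] * (x%:R `^ alpha)%:E < +oo ->
  ((fun n => (expR (- n%:R * L))%:E *
     'E_P[fun w => ((X Z (X0 w) n w)%:R `^ alpha)%R]) @ \oo -->
   \sum_(0 <= x <oo) nu [set x] * c x) /\
  \sum_(0 <= x <oo) nu [set x] * c x < +oo.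
Proof.
move=> al0 K0 KW X0nu iX0 nufin.
have c0 := moment_const_ge0 Z Pa m lambda alpha.
have mX0 (f : nat -> \bar R) : measurable_fun setT (fun w => f (X0 w)).
  exact: (measurableT_comp (measurable_fun_nat f)).
have sumE (f : nat -> \bar R) : (forall k, 0 <= f k) ->
    \int[P]_w f (X0 w) = \sum_(0 <= x <oo) nu [set x] * f x.
  by move=> f0; rewrite integral_nat_valued//; apply: eq_eseriesr => k _; rewrite X0nu.
have momE n : (expR (- n%:R * L))%:E *
    'E_P[fun w => ((X Z (X0 w) n w)%:R `^ alpha)%R] = \int[P]_w Wmom n (X0 w).
  rewrite unlock.
  pose F (z : nat * (process nat S * process (nat * nat)%type nat)) : \bar R :=
    ((X (canonical_data Z) z.1 n z.2)%:R `^ alpha)%:E.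
  have mF : measurable_fun setT F.
    apply: (measurable_fun_nat_bind (N := fst)
      (F := fun k (z : nat * (process nat S * process (nat * nat)%type nat)) =>
        ((X (canonical_data Z) k n z.2)%:R `^ alpha)%:E : \bar R)).
      exact: measurable_fst.
    move=> k; exact: (measurableT_comp (measurable_fun_X (canonical_data Z) k n
      (fun j => (j%:R `^ alpha)%:E : \bar R)) measurable_snd).
  have F0 z : 0 <= F z by rewrite lee_fin powR_ge0.
  transitivity ((expR (- n%:R * L))%:E * \int[P]_w F (X0 w, history Z w)).
    congr (_ * _); apply: eq_integral => w _; by rewrite /F X_history.
  rewrite (integral_independent (Y' := history Z) (P' := P) _ _ _ iX0)//.
  - rewrite -ge0_integralZl//.
    + apply: eq_integral => w _.
      rewrite (transition_iterate (m := m) (lambda := lambda) (alpha := alpha)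
        (a := Wmom) hZ n (X0 w)); last 2 first.
      * by move=> *; exact: W_moment_ge0.
      * by move=> *; exact: W_momentS.
      congr (_ * _); apply: eq_integral => w' _.
      by rewrite W_moment0 /F X_history.
    + exact: (mX0 (fun k => \int[P]_w F (k, history Z w))).
    + by move=> w _; exact: integral_ge0.
  - exact: measurable_history.
  - exact: measurable_history.
(* Integrable because nu has a finite moment of order alpha; it bounds all moments of W_n at
   once. *)
pose g w := (K * (1 + (X0 w)%:R `^ alpha))%:E : \bar R.
have g0 w : 0 <= g w by rewrite lee_fin mulr_ge0// addr_ge0// powR_ge0.
have gfin : \int[P]_w g w < +oo.
  rewrite /g; under eq_integral do rewrite EFinM EFinD.
  rewrite ge0_integralZl//; last 2 first.
  - exact: (mX0 (fun k => 1 + (k%:R `^ alpha)%:E)).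
  - by move=> w _; rewrite adde_ge0// lee_fin powR_ge0.
  rewrite ge0_integralD//; last exact: (mX0 (fun k => (k%:R `^ alpha)%:E)).
  rewrite integral_cst// mul1e [X in _ * (X + _)](_ : _ = 1); last first.
    exact: probability_setT.
  rewrite lte_mul_pinfty ?lee_fin// lte_add_pinfty ?ltry//.
  by rewrite (sumE (fun k => (k%:R `^ alpha)%:E)).
have ig : P.-integrable setT g.
  apply/integrableP; split.
    exact: (mX0 (fun k => (K * (1 + k%:R `^ alpha))%:E)).
  by under eq_integral do rewrite gee0_abs//.
have Wg n w : `|Wmom n (X0 w)| <= g w.
  by rewrite gee0_abs ?W_moment_ge0//; exact: (KW (X0 w)).1.
have [_ _ lim] := dominated_convergence measurableT
  (f_ := fun n w => Wmom n (X0 w)) (f := fun w => c (X0 w))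
  (fun n => mX0 (Wmom n)) (mX0 c)
  (aeW P (fun w _ => (KW (X0 w)).2)) ig
  (aeW P (fun w n _ => Wg n w)).
rewrite -sumE//; split.
  by apply: cvg_trans lim; apply: near_eq_cvg; apply: nearW => n; rewrite momE.
apply: le_lt_trans gfin; apply: ge0_le_integral => //.
- exact: (mX0 (fun k => (K * (1 + k%:R `^ alpha))%:E)).
- move=> w _; have [Wle Wc] := KW (X0 w).
  rewrite -(cvg_lim _ Wc)//; apply: lime_le; last exact: nearW.
  by apply/cvg_ex; exists (c (X0 w)).
Qed.

End harmonic.

Theorem proposition2p2
  (R : realType)
  (d : measure_display) (T : measurableType d)
  (dS : measure_display) (S : measurableType dS)
  (Z : branching_data T S) (P : probability T R)
  (m lambda alpha beta C mu : R) (Pa : probability T R)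
  (hZ : iid_environment_and_offspring Z P)
  (hm : 'E_P[fun w => (offspring Z 0 0 w)%:R%R]%E = m%:E)
  (m_gt0 : 0 < m)
  (lambda_gt0 : 0 < lambda)
  (alpha_gt0 : 0 < alpha)
  (halpha : interior (D_Lambda Z m lambda P) alpha)
  (hnonarith : non_arithmetic P (fun w => ln (M Z m lambda 0 w)))
  (hlogM : P.-integrable [set: T] (fun w => (ln (M Z m lambda 0 w))%:E))
  (hmu : 'E_P[fun w => ln (M Z m lambda 0 w)]%E = mu%:E)
  (mu_ge0 : 0 <= mu)
  (hrho : mu < derive1 (Lambda Z m lambda P) alpha)
  (hLambda2 : 0 < derive1n 2 (Lambda Z m lambda P) alpha)
  (beta_ge0 : 0 <= beta) (beta_lt : beta < alpha)
  (hD : forall k : nat,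
    ('E_P[fun w => (`|D Z m lambda k w| `^ alpha)%R] <=
      (C * (1 + k%:R `^ beta))%R%:E)%E)
  (hPa : tilted_law Z m lambda P alpha Pa) :
  let c := moment_const Z m lambda Pa alpha in
  let L := Lambda Z m lambda P alpha in
  {ae Pa, forall w, forall x : nat,
    cvgn (fun n => (X Z x n w)%:R / Delta Z m lambda n w : R)} /\
  (forall (d' : measure_display) (T' : measurableType d')
     (P' : probability T' R)
     (MPsi : {mfun T' >-> (R * process nat nat)%type})
     (V' : {mfun T' >-> process nat R}),
    same_law P' MPsi Pa (M_Psi Z m lambda) ->
    same_law P' V' Pa (V_process Z m lambda) ->
    independent P' MPsi V' ->
    same_law Pa (V_process Z m lambda)
      P' ((fun w x => (MPsi w).1^-1 * V' w ((MPsi w).2 x))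
            : T' -> process nat R)) /\
  (forall x, transition Z P c x = ((expR L)%:E * c x)%E) /\
  (forall x, (0 <= c x < +oo)%E) /\
  (forall x, (exists n y, (0 < P [set w | X Z x n w = y])%E /\ (0 < c y)%E) ->
    (0 < c x)%E) /\
  (forall (nu : probability nat R) (X0 : {mfun T >-> nat}),
    (forall A, P (X0 @^-1` A) = nu A) ->
    independent P X0
      ((fun w => (marks Z w, offspring_array Z w))
         : T -> (process nat S * process (nat * nat)%type nat)%type) ->
    (\sum_(0 <= x <oo) nu [set x] * (x%:R `^ alpha)%R%:E < +oo)%E ->
    ((fun n => (expR (- n%:R * L))%R%:E *
               'E_P[fun w => ((X Z (X0 w) n w)%:R `^ alpha)%R])%E @ \oo -->
       (\sum_(0 <= x <oo) nu [set x] * c x)%E) /\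
    (\sum_(0 <= x <oo) nu [set x] * c x < +oo)%E).
Proof.
move=> c L.
have hD0 : D_Lambda Z m lambda P alpha by exact: interior_subset halpha.
have L0 : 0 < L := Lambda_gt0 m_gt0 lambda_gt0 alpha_gt0 hnonarith hlogM hmu
  mu_ge0 hD0.
have [q [K [q0 q1 K0 incr]]] := increment_moment_geometric m_gt0 lambda_gt0 hZ hPa
  alpha_gt0 beta_ge0 beta_lt hD L0.
split; first exact: (W_converges m_gt0 lambda_gt0 alpha_gt0 q0 q1 K0 incr).
split.
  move=> d' T' P' MPsi V'; apply: V_process_law => //.
  exact: (tilted_iid m_gt0 lambda_gt0 hZ hPa).
split; first by move=> x; exact: transition_moment_const.
split.
  have [K' _ cK] := moment_const_le m_gt0 lambda_gt0 alpha_gt0 q0 q1 K0 incr.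
  by move=> x; rewrite moment_const_ge0 (le_lt_trans (cK x)) ?ltry.
split.
  move=> x [n [y [Py cy]]].
  exact: (moment_const_gt0 m_gt0 lambda_gt0 hZ hPa Py cy).
have [K' K'0 KW] := W_moment_cvg m_gt0 lambda_gt0 alpha_gt0 q0 q1 K0 incr.
move=> nu X0 X0nu iX0 nufin.
exact: (initial_law_limit m_gt0 lambda_gt0 hZ hPa alpha_gt0 K'0 KW X0nu iX0 nufin).
Qed.
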